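(* The Hausdorff dimension $HD(M\setminus L)$ of the complement of the Lagrange spectrum $L$ in the Markov spectrum $M$ satisfies $$0.353 < HD(M\setminus L).$$
   Context: $HD$ denotes Hausdorff dimension of subsets of $\mathbb{R}$. The Lagrange spectrum is $L=\left\{\limsup_{p,q\to\infty,\ p,q\in\mathbb{Z}} \frac{1}{|q(q\alpha-p)|}<\infty:\alpha\in\mathbb{R}\setminus\mathbb{Q}\right\}$ and the Markov spectrum is $M=\left\{\frac{1}{\inf_{(x,y)\in\mathbb{Z}^2\setminus\{(0,0)\}} |q(x,y)|}<\infty: q(x,y)=ax^2+bxy+cy^2 \text{ real indefinite},\ b^2-4ac=1 \right\}$. Equivalently (Perron, 1921; this is the characterization the paper works with): let $\mathbb{N}^*=\{1,2,3,\dots\}$, let $[a_0;a_1,a_2,\dots]=a_0+\frac{1}{a_1+\frac{1}{a_2+\cdots}}$ denote continued fractions, and for $A=(a_n)_{n\in\mathbb{Z}}\in(\mathbb{N}^* )^{\mathbb{Z}}$ and $i\in\mathbb{Z}$ put $\lambda_i(A)=[a_i;a_{i+1},a_{i+2},\dots]+[0;a_{i-1},a_{i-2},\dots]$, $\ell(A)=\limsup_{i\to\infty}\lambda_i(A)$, $m(A)=\sup_{i\in\mathbb{Z}}\lambda_i(A)$. Then $L=\{\ell(A)<\infty:A\in(\mathbb{N}^* )^{\mathbb{Z}}\}$ and $M=\{m(A)<\infty:A\in(\mathbb{N}^* )^{\mathbb{Z}}\}$. *)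

(* Defs.v *)
From HB Require Import structures.
From mathcomp Require Import all_boot all_order all_algebra.
From mathcomp Require Import all_classical all_reals all_analysis.

Set Implicit Arguments.
Unset Strict Implicit.
Unset Printing Implicit Defensive.

Import Order.TTheory GRing.Theory Num.Theory.

Local Open Scope classical_set_scope.
Local Open Scope ring_scope.

Section spectra.
Context {R : realType}.

(* limsup of 1 / |q (q alpha - p)| as p, q -> oo in Z, where "p, q -> oo" means
   |p| -> oo and |q| -> oo: both signs are allowed, since a negative alpha is
   approximated by p / q with p and q of opposite signs. *)
Definition lagrange_value (alpha : R) : \bar R :=
  ereal_inf
    [set ereal_sup
           [set (1 / `|pq.2%:~R * (pq.2%:~R * alpha - pq.1%:~R)|)%:E
             | pq in [set pq : int * int | (N <= `|pq.1|)%N /\ (N <= `|pq.2|)%N]]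
      | N in [set: nat]].

Definition lagrange_spectrum : set R :=
  [set x | exists2 alpha, irrational alpha & lagrange_value alpha = x%:E].

Definition qform (a b c x y : R) : R := a * x ^+ 2 + b * x * y + c * y ^+ 2.

Definition indefinite (a b c : R) : Prop :=
  (exists x y, 0 < qform a b c x y) /\ (exists x y, qform a b c x y < 0).

Definition qform_inf (a b c : R) : R :=
  inf [set `|qform a b c xy.1%:~R xy.2%:~R|
        | xy in [set xy : int * int | xy != (0, 0)]].

(* [0 < qform_inf a b c] says that 1 / inf is finite (here 1 / 0 = 0). *)
Definition markov_spectrum : set R :=
  [set x | exists a b c : R,
     [/\ indefinite a b c, b ^+ 2 - 4 * a * c = 1,
         0 < qform_inf a b c & x = 1 / qform_inf a b c]].

End spectra.

Section hausdorff.
Context {R : realType}.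
Local Open Scope ereal_scope.

(* This is -oo on the empty set. *)
Definition diam (U : set R) : \bar R :=
  ereal_sup [set `|x - y|%:E | x in U & y in U].

(* The gauge is 0 on the empty set and 1 on points when s = 0, so that the
   0-dimensional measure is the counting measure. *)
Definition hausdorff_gauge (s : R) (U : set R) : \bar R :=
  if U == set0 then 0 else diam U `^ s.

Definition hausdorff_content (s delta : R) (A : set R) : \bar R :=
  ereal_inf [set \sum_(k <oo) hausdorff_gauge s (U k)
              | U in [set U : (set R)^nat |
                       A `<=` \bigcup_k U k /\
                       forall k, diam (U k) <= delta%:E]].

Definition hausdorff_measure (s : R) (A : set R) : \bar R :=
  ereal_sup [set hausdorff_content s delta A
              | delta in [set delta : R | (0 < delta)%R]].

Definition hausdorff_dim (A : set R) : \bar R :=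
  ereal_inf [set s%:E
              | s in [set s : R | (0 <= s)%R /\ hausdorff_measure s A = 0]].

End hausdorff.

(* Main.v *)
Require Import Defs.
From Stdlib Require Import BinNat Nnat.
From mathcomp Require Import all_boot all_order all_algebra.
From mathcomp Require Import all_classical all_reals all_analysis.
From mathcomp Require Import zify ring lra.

(** Write lambda_i for Perron's height of a bi-infinite word of digits at position i. The lower
    bound comes from an explicit Cantor set of Markov values near 3.7097.

    Take the word that is periodic of period 3222123 on the left and up to position 12 on the
    right of an occurrence of its first digit 3, placed at position 0, that continues with
    2 1 2 1 2, and that ends with an arbitrary sequence b of digits 1 and 2. Its height at 0 lies
    in a tiny window of length 10^(-12) and all its other heights lie below that window
    ([family_value_itv], [lam_other]). Hence the height at 0 is the supremum of the heights, and
    it is a Markov value: the Euclidean algorithm, run on the coordinates of an integer vector,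
    shows that the absolute value of the associated form of discriminant 1 at a nonzero vector
    is never smaller than the inverse of the largest height ([descent], [lam_markov]).

    It is not a Lagrange value. If it were the Lagrange value of a number alpha, the heights of
    the expansion of alpha would eventually stay below the top of the window and enter the
    window infinitely often ([regular_tail]). A finite search shows that a height in the window
    forces the period on 17 digits on one side and 12 on the other ([window_agree]), and a
    second one that the period then replicates itself by one more period on the long side, as
    long as no height exceeds the top of the window ([agree_step]). So the period fills everything
    up to another position whose height is in the window, although heights in a periodic
    stretch are below the window ([recurrent_absurd]). On the other side the period
    may stop, as it does in the words of the family.

    Finally, sequences b that first differ at index n give heights at distance at least
    c (4/25)^n, because denominators of words in 1 and 2 grow at most like (5/2)^n
    ([family_sep]). A cover of the set of these heights by sets U_k therefore pulls back to a
    cover of {0,1}^N by cylinders whose masses are at most a constant times diam(U_k)^(9/25), since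
    2 (4/25)^(9/25) >= 1. The masses add up to at least 1, so the dimension is at least
    9/25 > 0.353 ([hausdorff_dim_ge]). *)

Set Implicit Arguments.
Unset Strict Implicit.
Unset Printing Implicit Defensive.

Import Order.TTheory GRing.Theory Num.Theory.
Import numFieldNormedType.Exports.

Delimit Scope N_scope with binnat.

Local Open Scope classical_set_scope.
Local Open Scope ring_scope.

(** * Finite continued fractions and their rational enclosures *)

(** Fractions are unreduced pairs (numerator, denominator) of binary numbers: a continued
    fraction is then evaluated with additions and multiplications only, fast enough to
    compare heights inside an exhaustive search. *)
Definition frac_cf (s : seq nat) (t : N * N) : N * N :=
  foldr (fun a x => (x.2, (N.of_nat a * x.2 + x.1)%binnat)) t s.

(** [1/4, 4/5] is mapped into itself by t |-> 1/(a + t) for a = 1, 2, 3, so it contains every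
    continued fraction [0; a1, a2, ...] with these digits. *)
Definition tail_lo : N * N := (1, 4)%binnat.
Definition tail_hi : N * N := (4, 5)%binnat.

(** The map t |-> [0; s + t] increases or decreases according to the parity of the length of s;
    this decides which end of the tail interval gives the lower bound. *)
Definition cf_lo s := frac_cf s (if odd (size s) then tail_hi else tail_lo).
Definition cf_hi s := frac_cf s (if odd (size s) then tail_lo else tail_hi).
Definition frac_sum (c : nat) (x y : N * N) : N * N :=
  ((N.of_nat c * (x.2 * y.2) + x.1 * y.2 + y.1 * x.2)%binnat, (x.2 * y.2)%binnat).
Definition frac_lt (u v : N * N) : bool := N.ltb (u.1 * v.2) (v.1 * u.2).

(** The digits on the left of the central digit [c] are listed in [l] from right to left, so
    that both [l] and [r] start next to [c] and the height is c + [0; r...] + [0; l...]. *)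
Definition surely_below b (l : seq nat) c r := frac_lt (frac_sum c (cf_hi l) (cf_hi r)) b.
Definition surely_above b (l : seq nat) c r := frac_lt b (frac_sum c (cf_lo l) (cf_lo r)).

(** The window of heights. The periodic word of period 3222123 has height 3.70969985967967...,
    just below the window; the words of the family lie between 3.70969985975025 and
    3.70969985975058, inside it; breaking the period on the opposite side costs a height of
    about 3.7096998597515, above it. *)
Definition height_lo : N * N := (3709699859750, 1000000000000)%binnat.
Definition height_hi : N * N := (3709699859751, 1000000000000)%binnat.

Fixpoint surely_above_right b l c r : bool :=
  if surely_above b l c r then true else
  if r is d :: r' then surely_above_right b (c :: l) d r' else false.
Definition surely_above_somewhere b l c r :=
  if surely_above_right b l c r then true else surely_above_right b r c l.

(** A branch is closed as soon as [prune] excludes its word; [dirs] says on which side each next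
    digit goes. The conditionals are not written with boolean connectives because those would
    evaluate the pruned branches too. *)
Fixpoint explore (prune good : seq nat -> seq nat -> bool) (dirs : seq bool) l r : bool :=
  if prune l r then true else
  if dirs is b :: dirs' then
    all (fun d => if b then explore prune good dirs' (rcons l d) r
                  else explore prune good dirs' l (rcons r d)) [:: 1; 2; 3]%N
  else good l r.

Lemma ltb_to_nat x y : N.ltb x y -> (N.to_nat x < N.to_nat y)%N.
Proof. lia. Qed.

Section Cfr.
Variable R : realFieldType.
Implicit Types (s : seq nat) (t u : R) (x y : N * N).

Definition cfr s t : R := foldr (fun a v => (a%:R + v)^-1) t s.

(** Locked, so that conversion never expands the unary numbers hidden in the denominators. *)
Definition frac_val x : R := locked ((N.to_nat x.1)%:R / (N.to_nat x.2)%:R).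
Definition frac_pos x := (0 < N.to_nat x.1)%N && (0 < N.to_nat x.2)%N.

Lemma frac_valE x : frac_val x = (N.to_nat x.1)%:R / (N.to_nat x.2)%:R.
Proof. by rewrite /frac_val -lock. Qed.

Lemma frac_cfE s x : frac_pos x ->
  frac_pos (frac_cf s x) /\ frac_val (frac_cf s x) = cfr s (frac_val x).
Proof.
move=> x0; elim: s => //= a s [/andP[p1 p2] <-].
rewrite /frac_pos !frac_valE /= N2Nat.inj_add N2Nat.inj_mul Nat2N.id.
rewrite p2 addn_gt0 p1 orbT; split=> //.
have h1 : 0 < (N.to_nat (frac_cf s x).1)%:R :> R by rewrite ltr0n.
have h2 : 0 < (N.to_nat (frac_cf s x).2)%:R :> R by rewrite ltr0n.
have h3 : 0 <= a%:R :> R by rewrite ler0n.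
rewrite natrD natrM; field; apply/andP; split; nra.
Qed.

Lemma frac_sumE c x y : frac_pos x -> frac_pos y ->
  (0 < N.to_nat (frac_sum c x y).2)%N /\ frac_val (frac_sum c x y) = c%:R + frac_val x + frac_val y.
Proof.
move=> /andP[p1 p2] /andP[p3 p4]; rewrite !frac_valE /=.
rewrite !N2Nat.inj_add !N2Nat.inj_mul Nat2N.id muln_gt0 p2 p4; split=> //.
have h2 : 0 < (N.to_nat x.2)%:R :> R by rewrite ltr0n.
have h4 : 0 < (N.to_nat y.2)%:R :> R by rewrite ltr0n.
by rewrite !natrD !natrM; field; apply/andP; split; nra.
Qed.

Lemma frac_lt_val x y : (0 < N.to_nat x.2)%N -> (0 < N.to_nat y.2)%N ->
  frac_lt x y -> frac_val x < frac_val y.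
Proof.
move=> p2 p4 /ltb_to_nat; rewrite !N2Nat.inj_mul => h.
by rewrite !frac_valE ltr_pdivrMr ?ltr0n// mulrAC ltr_pdivlMr ?ltr0n// -!natrM ltr_nat.
Qed.

Lemma cfr_mono s t u : 0 < t -> t <= u ->
  if odd (size s) then cfr s u <= cfr s t else cfr s t <= cfr s u.
Proof.
move=> t0 tu; have u0 : 0 < u by lra.
have pos v : 0 < v -> forall s, 0 < cfr s v.
  by move=> v0; elim=> //= a s' IH; rewrite invr_gt0 ltr_wpDl.
elim: s => //= a s; have [pt pu] := (pos _ t0 s, pos _ u0 s).
have a0 : 0 <= a%:R :> R by [].
by case: (odd _) => /= IH; rewrite lef_pV2 ?posrE ?ltr_wpDl ?lerD2l.
Qed.

Lemma cf_bounds s t : 1 / 4 <= t -> t <= 4 / 5 ->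
  frac_val (cf_lo s) <= cfr s t <= frac_val (cf_hi s).
Proof.
move=> t1 t2.
have E1 : frac_val tail_lo = 1 / 4 by rewrite frac_valE.
have E2 : frac_val tail_hi = 4 / 5 by rewrite frac_valE.
have h1 := @cfr_mono s (1 / 4) t ltac:(lra) t1.
have h2 := @cfr_mono s t (4 / 5) ltac:(lra) t2.
rewrite /cf_lo /cf_hi; case: (odd (size s)) h1 h2 => h1 h2; apply/andP; split;
  by rewrite (frac_cfE _ _).2 // ?E1 ?E2.
Qed.

Lemma cf_lo_pos s : frac_pos (cf_lo s).
Proof. by rewrite /cf_lo; case: ifP => _; apply: (frac_cfE s _).1. Qed.

Lemma cf_hi_pos s : frac_pos (cf_hi s).
Proof. by rewrite /cf_hi; case: ifP => _; apply: (frac_cfE s _).1. Qed.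

Lemma surely_below_val b l c r t u : (0 < N.to_nat b.2)%N ->
    1 / 4 <= t <= 4 / 5 -> 1 / 4 <= u <= 4 / 5 -> surely_below b l c r ->
  c%:R + cfr r t + cfr l u < frac_val b.
Proof.
move=> b0 /andP[t1 t2] /andP[u1 u2].
have [p e] := frac_sumE c (cf_hi_pos l) (cf_hi_pos r).
move/(frac_lt_val p b0); rewrite e.
have /andP[_] := cf_bounds r t1 t2; have /andP[_] := cf_bounds l u1 u2.
lra.
Qed.

Lemma surely_above_val b l c r t u : (0 < N.to_nat b.2)%N ->
    1 / 4 <= t <= 4 / 5 -> 1 / 4 <= u <= 4 / 5 -> surely_above b l c r ->
  frac_val b < c%:R + cfr r t + cfr l u.
Proof.
move=> b0 /andP[t1 t2] /andP[u1 u2].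
have [p e] := frac_sumE c (cf_lo_pos l) (cf_lo_pos r).
move/(frac_lt_val b0 p); rewrite e.
have /andP[+ _] := cf_bounds r t1 t2; have /andP[+ _] := cf_bounds l u1 u2.
lra.
Qed.

Lemma height_lo_gt : 37 / 10 < frac_val height_lo.
Proof. by rewrite (_ : 37 / 10 = frac_val (37, 10)%binnat) ?frac_lt_val // frac_valE. Qed.

Lemma height_lo_gt2 : 2 < frac_val height_lo.
Proof. by apply: lt_trans height_lo_gt; lra. Qed.

Lemma height_hi_lt : frac_val height_hi < 4.
Proof. by rewrite (_ : 4 = frac_val (4, 1)%binnat) ?frac_lt_val // frac_valE divr1. Qed.
End Cfr.

(** * Digits around a position *)

Fixpoint rdigits (d : int -> nat) (i : int) k : seq nat :=
  if k is k'.+1 then d (i + 1) :: rdigits d (i + 1) k' else [::].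
Definition ldigits (d : int -> nat) i k := rdigits (fun j => d (- j)) (- i) k.

Lemma eq_rdigitsP d e i j k :
  rdigits d i k = rdigits e j k <->
  (forall t : int, 1 <= t <= k%:Z -> d (i + t) = e (j + t)).
Proof.
elim: k i j => [|k IH] i j /=.
  by split=> // _ t /andP[t1 t2]; lia.
split=> [[h /IH h'] t tk|h].
  have [->//|t1] := eqVneq t 1.
  have := h' (t - 1) ltac:(lia).
  by rewrite -!addrA [1 + (t - 1)]addrC subrK.
congr cons; first by apply: h; lia.
by apply/IH => t tk; rewrite -!addrA; apply: h; lia.
Qed.

Lemma eq_ldigitsP d e i j k :
  ldigits d i k = ldigits e j k <->
  (forall t : int, 1 <= t <= k%:Z -> d (i - t) = e (j - t)).
Proof.
rewrite /ldigits eq_rdigitsP; split=> h t /h; first by rewrite !opprD !opprK.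
by rewrite !opprD !opprK.
Qed.

Lemma rdigits_rcons d i k : rdigits d i k.+1 = rcons (rdigits d i k) (d (i + k.+1%:Z)).
Proof.
elim: k i => //= k IH i.
rewrite [in LHS]IH; congr (_ :: rcons _ (d _)); lia.
Qed.

Lemma ldigits_rcons d i k : ldigits d i k.+1 = rcons (ldigits d i k) (d (i - k.+1%:Z)).
Proof. by rewrite /ldigits rdigits_rcons opprD opprK. Qed.

Lemma ldigits_cons d i k : ldigits d (i + 1) k.+1 = d i :: ldigits d i k.
Proof. by rewrite /ldigits /= (_ : - (i + 1) + 1 = - i) ?opprK; last lia. Qed.

Lemma take_rdigits d i n k : (n <= k)%N -> take n (rdigits d i k) = rdigits d i n.
Proof. by elim: n k i => [|n IH] [|k] i //= nk; rewrite IH. Qed.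

Definition period_digit (t : int) : nat := nth 0%N [:: 3; 2; 2; 2; 1; 2; 3]%N `|(t %% 7)%Z|%N.

Lemma period_digit_shift (k t : int) : period_digit (7 * k + t) = period_digit t.
Proof. by rewrite /period_digit mulrC modzMDl. Qed.

Definition prune_high l r := surely_above_somewhere height_hi l 3 r.
Definition prune_window l r := if surely_below height_lo l 3 r then true else prune_high l r.
Definition good_window l r :=
  ((take 17 l == ldigits period_digit 0 17) && (take 12 r == rdigits period_digit 0 12)) ||
  ((take 17 r == ldigits period_digit 0 17) && (take 12 l == rdigits period_digit 0 12)).

(** The left and the right digits alternate, so that a wrong digit is detected as early as
    possible. The survivors show the period for 17 digits on one side, while on the other side
    it may be left after 12 digits. *)
Lemma explore_window :
  explore prune_window good_window (flatten (nseq 17 [:: false; true])) [::] [::].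
Proof. by vm_compute. Qed.

(** Once the period is known on ten digits to the left and nineteen to the right, any other
    continuation by seven digits to the left creates a height above the window. *)
Lemma explore_step :
  explore prune_high (fun l _ => l == ldigits period_digit 0 17)
          (nseq 7 true) (ldigits period_digit 0 10) (rdigits period_digit 0 19).
Proof. by vm_compute. Qed.

(** Twenty digits on each side determine the heights far more precisely than the distance from
    the height of the periodic word to the window. *)
Lemma periodic_surely_below :
  all (fun t : nat => surely_below height_lo
         (ldigits period_digit t 20) (period_digit t) (rdigits period_digit t 20)) (iota 0 7).
Proof. by vm_compute. Qed.

(** * Heights of two-sided sequences and replication of the period *)

Section TwoSided.
Variable R : realFieldType.

(** The two tails are kept as functions of the position instead of being computed from the digits:
    for the expansion of a real number the backward tail is a finite continued fraction, for
    a bi-infinite word it is an infinite one, and only their recurrences matter. *)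
Record twosided := TwoSided { dig : int -> nat; fwd : int -> R; bwd : int -> R }.
Definition mirror x :=
  TwoSided (fun j => dig x (- j)) (fun j => bwd x (- j)) (fun j => fwd x (- j)).

(** Perron's height of a position. *)
Definition lam x j : R := (dig x j)%:R + fwd x j + bwd x j.
Definition regular x j :=
  [/\ (1 <= dig x j <= 3)%N,
      1 / 4 <= fwd x j <= 4 / 5, 1 / 4 <= bwd x j <= 4 / 5,
      fwd x j = ((dig x (j + 1))%:R + fwd x (j + 1))^-1 &
      bwd x j = ((dig x (j - 1))%:R + bwd x (j - 1))^-1].

Lemma regular_mirror x j : regular x (- j) -> regular (mirror x) j.
Proof.
by case=> h1 h2 h3 h4 h5; split; rewrite //= ?opprD ?opprK.
Qed.

Lemma lam_mirror x j : lam (mirror x) j = lam x (- j).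
Proof. by rewrite /lam /= addrAC. Qed.

Lemma fwd_cfr x i k : (forall j, i <= j < i + k%:Z -> regular x j) ->
  fwd x i = cfr (rdigits (dig x) i k) (fwd x (i + k%:Z)).
Proof.
elim: k i => [|k IH] i h /=; first by rewrite addr0.
have [|_ _ _ -> _] := h i; first by lia.
rewrite IH => [|j hj]; last by apply: h; lia.
by congr ((_ + cfr _ (fwd x _))^-1); lia.
Qed.

Lemma bwd_cfr x i k : (forall j, i - k%:Z < j <= i -> regular x j) ->
  bwd x i = cfr (ldigits (dig x) i k) (bwd x (i - k%:Z)).
Proof.
move=> h; have := @fwd_cfr (mirror x) (- i) k.
rewrite /= opprK opprD opprK; apply=> j hj.
by apply/regular_mirror/h; lia.
Qed.

Section Window.
Variables (x : twosided) (i : int) (kl kr : nat).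
Hypothesis reg : forall j, i - kl%:Z <= j <= i + kr%:Z -> regular x j.

Lemma lam_cfr : lam x i = (dig x i)%:R + cfr (rdigits (dig x) i kr) (fwd x (i + kr%:Z))
                          + cfr (ldigits (dig x) i kl) (bwd x (i - kl%:Z)).
Proof.
rewrite /lam (@fwd_cfr x i kr) ?(@bwd_cfr x i kl) // => j hj; apply: reg; lia.
Qed.

Lemma lam_below b : (0 < N.to_nat b.2)%N ->
  surely_below b (ldigits (dig x) i kl) (dig x i) (rdigits (dig x) i kr) -> lam x i < frac_val R b.
Proof.
move=> b0; rewrite lam_cfr; apply: surely_below_val => //.
  by have [|_ ? _ _ _] := @reg (i + kr%:Z); first lia.
by have [|_ _ ? _ _] := @reg (i - kl%:Z); first lia.
Qed.

Lemma lam_above b : (0 < N.to_nat b.2)%N ->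
  surely_above b (ldigits (dig x) i kl) (dig x i) (rdigits (dig x) i kr) -> frac_val R b < lam x i.
Proof.
move=> b0; rewrite lam_cfr; apply: surely_above_val => //.
  by have [|_ ? _ _ _] := @reg (i + kr%:Z); first lia.
by have [|_ _ ? _ _] := @reg (i - kl%:Z); first lia.
Qed.
End Window.

(** Moving the first digit of the right list to the centre recentres the same window at the next
    position, so a true window is never rejected when all its heights are in range. *)
Lemma surely_above_rightF b x i kl kr : (0 < N.to_nat b.2)%N ->
    (forall j, i - kl%:Z <= j <= i + kr%:Z -> regular x j /\ lam x j <= frac_val R b) ->
  surely_above_right b (ldigits (dig x) i kl) (dig x i) (rdigits (dig x) i kr) = false.
Proof.
move=> b0; elim: kr i kl => [|kr IH] i kl h.
  case ab: (surely_above_right _ _ _ _) => //; have [|_] := h i; first lia.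
  rewrite leNgt (@lam_above x i kl 0) //; first by move=> j hj; apply: (h j _).1; lia.
  by move: ab => /=; case: ifP.
rewrite /=; case: ifP => [ab|_].
  have [|_] := h i; first lia.
  by rewrite leNgt (@lam_above x i kl kr.+1) // => j hj; apply: (h j _).1; lia.
by rewrite -ldigits_cons IH // => j hj; apply: h; lia.
Qed.

Lemma surely_above_somewhereF b x i kl kr : (0 < N.to_nat b.2)%N ->
    (forall j, i - kl%:Z <= j <= i + kr%:Z -> regular x j /\ lam x j <= frac_val R b) ->
  surely_above_somewhere b (ldigits (dig x) i kl) (dig x i) (rdigits (dig x) i kr) = false.
Proof.
move=> b0 h; rewrite /surely_above_somewhere surely_above_rightF //.
have := @surely_above_rightF b (mirror x) (- i) kr kl b0.
rewrite /ldigits /= !opprK; under [fun j => _]boolp.funext => j do rewrite opprK.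
apply=> j hj; have [|hr hl] := h (- j); first lia.
by split; [exact: regular_mirror|rewrite lam_mirror].
Qed.

Lemma exploreE (prune good : seq nat -> seq nat -> bool) b dirs l r :
  explore prune good (b :: dirs) l r =
  if prune l r then true else
  all (fun d => if b then explore prune good dirs (rcons l d) r
                else explore prune good dirs l (rcons r d)) [:: 1; 2; 3]%N.
Proof. by []. Qed.

(** The true digits around a position describe one branch of the search tree; since it is never
    pruned, the search reaches its leaf, where [good] was checked. *)
Lemma exploreP (prune good : seq nat -> seq nat -> bool) dirs (d : int -> nat) i kl kr KL KR :
    (kl + count id dirs <= KL)%N -> (kr + count negb dirs <= KR)%N ->
    (forall j, i - KL%:Z <= j <= i + KR%:Z -> (1 <= d j <= 3)%N) ->
    (forall l r, (l <= KL)%N -> (r <= KR)%N -> prune (ldigits d i l) (rdigits d i r) = false) ->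
  explore prune good dirs (ldigits d i kl) (rdigits d i kr) ->
  good (ldigits d i (kl + count id dirs)) (rdigits d i (kr + count negb dirs)).
Proof.
elim: dirs kl kr => [|b dirs IH] kl kr hl hr hd hp.
  by move: hl hr; rewrite /= !addn0 => hl hr; rewrite hp.
rewrite {1}[explore]lock /= in hl hr *; rewrite -lock exploreE hp; try lia.
have digit j : i - KL%:Z <= j <= i + KR%:Z -> d j \in [:: 1; 2; 3]%N.
  by move=> /hd; rewrite !inE; lia.
case: b hl hr => hl hr /allP h.
  rewrite [(true + _)%N]add1n [(~~ true + _)%N]add0n -addSnnS in hl hr *.
  apply: IH => //; rewrite ldigits_rcons; apply: h; apply: digit; lia.
rewrite [(false + _)%N]add0n [(~~ false + _)%N]add1n -addSnnS in hl hr *.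
apply: IH => //; rewrite rdigits_rcons; apply: h; apply: digit; lia.
Qed.

Definition agree (d : int -> nat) i (a b : nat) :=
  forall t : int, - a%:Z <= t <= b%:Z -> d (i + t) = period_digit t.

Lemma agreeP d i a b : d i = 3%N -> ldigits d i a = ldigits period_digit 0 a ->
  rdigits d i b = rdigits period_digit 0 b -> agree d i a b.
Proof.
move=> di /eq_ldigitsP hl /eq_rdigitsP hr t tab.
have [t0|t0|->] := ltgtP t 0; last by rewrite addr0 di.
- by have := hl (- t); rewrite opprK add0r => -> //; lia.
- by rewrite hr ?add0r //; lia.
Qed.

Lemma agree_digits d i a b : agree d i a b ->
  [/\ d i = 3%N, ldigits d i a = ldigits period_digit 0 a &
      rdigits d i b = rdigits period_digit 0 b].
Proof.
move=> h; split; first by rewrite -[i]addr0 h //; lia.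
- by apply/eq_ldigitsP => t ht; rewrite h ?add0r //; lia.
- by apply/eq_rdigitsP => t ht; rewrite h ?add0r //; lia.
Qed.

Section Rigidity.
Variables (x : twosided) (i : int).
Let dom j := regular x j /\ lam x j <= frac_val R height_hi.

Lemma dom_pruned KL KR : (forall j, i - KL%:Z <= j <= i + KR%:Z -> dom j) ->
    dig x i = 3%N -> forall l r, (l <= KL)%N -> (r <= KR)%N ->
  prune_high (ldigits (dig x) i l) (rdigits (dig x) i r) = false.
Proof.
move=> h d3 l r hl hr; rewrite /prune_high -d3 surely_above_somewhereF // => j hj.
by apply: h; lia.
Qed.

(** A digit 1 or 2 has too small a height, so the centre is a 3 and [explore_window] applies; its
    two alternatives are exchanged by reflection. *)
Lemma window_agree : (forall j, i - 17 <= j <= i + 17 -> dom j) ->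
    frac_val R height_lo <= lam x i ->
  agree (dig x) i 17 12 \/ agree (dig (mirror x)) (- i) 17 12.
Proof.
move=> h li; have [[d13 f1 b1 _ _] _] : dom i by apply: h; lia.
have di : dig x i = 3%N.
  (* Digits 1 and 2 have heights at most 2 + 8/5, below 3.7. *)
  move: li; rewrite /lam; have : (dig x i <= 3)%N by lia.
  rewrite leq_eqVlt => /orP[/eqP//|]; rewrite ltnS -(ler_nat R).
  have := height_lo_gt R.
  by move: f1 b1 => /andP[_ f1] /andP[_ b1] {d13 h} *; exfalso; lra.
have hd (j : int) : i - 17%:Z <= j <= i + 17%:Z -> (1 <= dig x j <= 3)%N.
  by move=> hj; have [[]] := h j ltac:(lia).
have hp l r : (l <= 17)%N -> (r <= 17)%N ->
    prune_window (ldigits (dig x) i l) (rdigits (dig x) i r) = false.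
  move=> hl hr; rewrite /prune_window (dom_pruned (KL := 17) (KR := 17)) //.
  case: ifP => //; rewrite -di => /(lam_below (x := x)) hb.
  move: li; rewrite leNgt hb // => j hj.
  by have [] := h j ltac:(lia).
have := exploreP (dirs := flatten (nseq 17 [:: false; true])) (kl := 0) (kr := 0)
  (leqnn 17) (leqnn 17) hd hp explore_window.
rewrite /good_window !take_rdigits // => /orP[].
- by case/andP => /eqP e1 /eqP e2; left; apply: agreeP.
case/andP => /eqP e1 /eqP e2; right; apply: agreeP => /=; first by rewrite opprK.
  rewrite -e1 /ldigits opprK; apply/eq_rdigitsP => t ht /=.
  by rewrite opprK.
exact: e2.
Qed.

(** The upper bound on the heights alone makes the period replicate itself by one more period. *)
Lemma agree_step : (forall j, i - 17 <= j <= i + 19 -> dom j) ->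
  agree (dig x) i 10 19 -> agree (dig x) i 17 19.
Proof.
move=> h /agree_digits [di el er].
have := explore_step; rewrite -el -er => E.
have hd (j : int) : i - 17%:Z <= j <= i + 19%:Z -> (1 <= dig x j <= 3)%N.
  by move=> hj; have [[]] := h j ltac:(lia).
have := exploreP (dirs := nseq 7 true) (kl := 10) (kr := 19)
  (leqnn 17) (leqnn 19) hd (dom_pruned h di) E.
by move/eqP => e; apply: (agreeP di e er).
Qed.
End Rigidity.

(** A period moved by seven positions is again on ten digits to the left and nineteen to the
    right of its new centre, so the replication step applies over and over. *)
Lemma agree_left x i (K : nat) :
    (forall j, i - (7 * K + 17)%:Z <= j <= i + 17 ->
       regular x j /\ lam x j <= frac_val R height_hi) ->
  agree (dig x) i 17 12 -> agree (dig x) i (7 * K + 17) 12.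
Proof.
elim: K => // K IH h h0.
have {}IH : agree (dig x) i (7 * K + 17) 12 by apply: IH => // j hj; apply: h; lia.
pose j := i - (7 * K + 7)%:Z.
have per t : period_digit (t - (7 * K + 7)%:Z) = period_digit t.
  by rewrite -(period_digit_shift (- (K.+1)%:Z) t); congr period_digit; lia.
have hj : agree (dig x) j 17 19.
  apply: agree_step => [k hk|t ht]; first by apply: h; lia.
  rewrite -per -IH; last lia.
  by congr (dig x); lia.
move=> t ht; have [t1|t1] := leP (- (7 * K + 17)%:Z) t; first by apply: IH; lia.
rewrite -[t in RHS](addrK (7 * K + 7)%:Z) per -hj; last lia.
by congr (dig x); lia.
Qed.

Lemma lam_periodic x i a b (t : int) : agree (dig x) i a b ->
    (forall j, i + t - 20 <= j <= i + t + 20 -> regular x j) ->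
  20 - a%:Z <= t <= b%:Z - 20 -> lam x (i + t) < frac_val R height_lo.
Proof.
move=> h reg ht; pose r := `|(t %% 7)%Z|%N.
have per s : period_digit (t + s) = period_digit (r%:Z + s).
  rewrite -(period_digit_shift (t %/ 7)%Z (r%:Z + s)) addrA; congr period_digit; congr (_ + s).
  by rewrite /r {1}(divz_eq t 7); lia.
have r7 : (r < 7)%N by rewrite /r; lia.
apply: (lam_below (kl := 20) (kr := 20)) => //.
have /allP/(_ r) := periodic_surely_below; rewrite mem_iota r7 => /(_ isT).
rewrite (_ : dig x (i + t) = period_digit r); last first.
  by have := per 0; rewrite !addr0 => <-; apply: h; lia.
rewrite (_ : ldigits (dig x) _ _ = ldigits period_digit r 20); last first.
  by apply/eq_ldigitsP => s hs; rewrite -addrA h ?per //; lia.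
rewrite (_ : rdigits (dig x) _ _ = rdigits period_digit r 20) //.
by apply/eq_rdigitsP => s hs; rewrite -addrA h ?per //; lia.
Qed.

(** The period extends from [i] past [i1], and inside a periodic stretch all heights are below
    the window. *)
Lemma no_earlier_high x i1 i :
    (forall j, i1 - 40 <= j <= i + 17 -> regular x j /\ lam x j <= frac_val R height_hi) ->
    i1 + 30 <= i -> agree (dig x) i 17 12 -> lam x i1 < frac_val R height_lo.
Proof.
move=> h hi h0.
(* Two periods more than the distance leave 20 periodic digits on the left of i1. *)
pose K := (`|(i - i1)%R|%N %/ 7).+2.
have hK : agree (dig x) i (7 * K + 17) 12.
  by apply: agree_left => // j hj; apply: h; rewrite /K in hj; lia.
rewrite -(subrKC i i1); apply: lam_periodic hK _ _.
  by move=> j hj; apply: (h j _).1; lia.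
by rewrite /K; lia.
Qed.

(** The period found at the second of three high positions replicates itself either to the left,
    and reaches the first one, or to the right, and reaches the third one. *)
Lemma recurrent_absurd x n1 :
    (forall j, n1 <= j -> regular x j /\ lam x j <= frac_val R height_hi) ->
  ~ (forall N : int, exists2 i, N <= i & frac_val R height_lo <= lam x i).
Proof.
move=> dom rec.
(* The distances leave room for the windows and for the replication on both sides. *)
have [i1 h1 l1] := rec (n1 + 60).
have [i2 h2 l2] := rec (i1 + 100).
have [i3 h3 l3] := rec (i2 + 100).
have [|a|a] := @window_agree x i2 _ l2; first by move=> j hj; apply: dom; lia.
  move: l1; rewrite leNgt (@no_earlier_high x i1 i2) //; try lia.
  by move=> j hj; apply: dom; lia.
move: l3; rewrite leNgt -[i3]opprK -lam_mirror (@no_earlier_high _ (- i3) (- i2)) //; try lia.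
move=> j hj; have [|r l] := dom (- j); first lia.
by split; [exact: regular_mirror|rewrite lam_mirror].
Qed.
End TwoSided.

(** * Reduction of indefinite binary forms *)

Section Descent.
Variable R : realFieldType.
Implicit Types (a b x y : nat) (xi eta : R).

(** The absolute value at (u, v) of the form of discriminant 1 with roots a + xi and - eta,
    whose leading coefficient is the inverse of the height a + xi + eta; the second factor is
    written without absolute value because u and v are nonnegative in all uses. *)
Definition formval (a : nat) (xi eta u v : R) : R :=
  `|u - (a%:R + xi) * v| * (u + eta * v) / (a%:R + xi + eta).

(** The unimodular substitution (u, v) -> (a u + v, u) carries the roots at one position of the
    expansion to the roots at the next one. *)
Lemma formval_step a a' (xi eta xi' eta' u v : R) :
    (0 < a)%N -> (0 < a')%N -> 0 < xi' -> 0 <= eta ->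
    xi = (a'%:R + xi')^-1 -> eta' = (a%:R + eta)^-1 ->
  formval a xi eta (a%:R * u + v) u = formval a' xi' eta' u v.
Proof.
rewrite -(ltr0n R) -(ltr0n R a') => a0 a'0 x'0 e0 -> ->; rewrite /formval.
set W := a'%:R + xi'; set H := a%:R + eta.
have W0 : 0 < W by rewrite /W; lra.
have H0 : 0 < H by rewrite /H; lra.
have -> : a%:R * u + v - (a%:R + W^-1) * u = - (u - W * v) / W.
  by field; lra.
rewrite normrM normrN normfV (gtr0_norm W0).
have -> : a%:R = H - eta by rewrite /H; ring.
have WH0 := mulr_gt0 W0 H0; field; apply/and3P; split; lra.
Qed.

Lemma formval_axis a xi eta (e : R) : 0 < e -> 0 < a%:R + xi + eta ->
  formval a xi eta e 0 = e ^+ 2 / (a%:R + xi + eta).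
Proof. by move=> e0 h; rewrite /formval !mulr0 subr0 addr0 gtr0_norm. Qed.

(** With P = (a + xi) y - x and Q = x + eta y the value is y P Q / (P + Q), and x < a y makes P
    and Q at least 1. *)
Lemma formval_low a xi eta x y : (x < a * y)%N -> (0 < x)%N -> 0 < xi -> 0 <= eta ->
  1 / 2 <= formval a xi eta x%:R y%:R.
Proof.
move=> xa x0 xi0 eta0.
have y0 : (0 < y)%N by lia.
have a0 : (0 < a)%N by lia.
have A0 : 0 < a%:R :> R by rewrite ltr0n.
have Y1 : 1 <= y%:R :> R by rewrite ler1n.
have X1 : 1 <= x%:R :> R by rewrite ler1n.
have XA : x%:R + 1 <= a%:R * y%:R :> R by rewrite -natrM natr1 ler_nat.
rewrite /formval; set P := (a%:R + xi) * y%:R - x%:R; set Q := x%:R + eta * y%:R.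
have P1 : 1 <= P by rewrite /P; nra.
have Q1 : 1 <= Q by rewrite /Q; nra.
rewrite distrC ger0_norm -/P; last by lra.
rewrite ler_pdivlMr; last by lra.
have E : P + Q = (a%:R + xi + eta) * y%:R by rewrite /P /Q; ring.
have h : a%:R + xi + eta <= P + Q by rewrite E; nra.
by nra.
Qed.

Definition chain (A : nat -> nat) (X Y : nat -> R) := forall n,
  [/\ (0 < A n)%N, 0 < X n, 0 <= Y n,
      X n = ((A n.+1)%:R + X n.+1)^-1 & Y n.+1 = ((A n)%:R + Y n)^-1].

Lemma chain_shift A X Y : chain A X Y ->
  chain (fun n => A n.+1) (fun n => X n.+1) (fun n => Y n.+1).
Proof. by move=> h n; apply: h. Qed.

(** Subtracting a y from x as long as possible is the Euclidean algorithm: it stops either in the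
    range of [formval_low] or on the axis, where the value is e^2 over a height. The last bound
    limits the size of the vectors that end at a given level with a given e. *)
Lemma descent A X Y x y : chain A X Y -> (0 < x)%N ->
  1 / 2 <= formval (A 0%N) (X 0%N) (Y 0%N) x%:R y%:R \/
  exists n e, [/\ (0 < e)%N,
    formval (A 0%N) (X 0%N) (Y 0%N) x%:R y%:R = e%:R ^+ 2 / ((A n)%:R + X n + Y n) &
    (x + y <= e * \prod_(k < n) (A k).+1)%N].
Proof.
have [N] := ubnP (x + y)%N; elim: N A X Y x y => // N IH A X Y x y xyN h x0.
have [a0 xi0 eta0 exi eeta] := h 0%N.
have A0 : 0 < (A 0%N)%:R :> R by rewrite ltr0n.
have [xa|ax] := ltnP x (A 0 * y)%N; first by left; apply: formval_low.
have [y0|y0] := posnP y.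
  right; exists 0%N, x; rewrite big_ord0 y0 addn0 muln1; split=> //.
  by rewrite formval_axis ?ltr0n //; lra.
have [a1 xi1 eta1 _ _] := h 1%N.
have -> : x%:R = (A 0%N)%:R * y%:R + (x - A 0 * y)%:R :> R.
  by rewrite -natrM -natrD subnKC.
rewrite (formval_step _ _ a0 a1 xi1 eta0 exi eeta).
have [|half|[n [e [e0 -> le]]]] := IH _ _ _ y (x - A 0 * y)%N _ (chain_shift h) y0.
- by rewrite ltnS in xyN; apply: leq_trans xyN; nia.
- by left.
right; exists n.+1, e; split=> //.
rewrite big_ord_recl /= [(_ * \prod_(_ < _) _)%N]mulnC mulnA.
apply: leq_trans (_ : (y + (x - A 0 * y)) * (A 0).+1 <= _)%N; last by rewrite leq_mul2r le orbT.
nia.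
Qed.

(** The inverse substitutions turn (1, 0) at level n into the n-th convergent, where the form takes
    the inverse of the n-th height. *)
Lemma ascent A X Y n : chain A X Y -> exists x y, [/\ (0 < x)%N, (y <= x)%N, (n < x + y)%N &
  formval (A 0%N) (X 0%N) (Y 0%N) x%:R y%:R = ((A n)%:R + X n + Y n)^-1].
Proof.
elim: n A X Y => [|n IH] A X Y h.
  have [a0 xi0 eta0 _ _] := h 0%N; have A0 : 0 < (A 0%N)%:R :> R by rewrite ltr0n.
  exists 1%N, 0%N; split=> //.
  by rewrite formval_axis ?expr1n ?div1r //; lra.
have [x [y [x0 yx nxy <-]]] := IH _ _ _ (chain_shift h).
have [a0 xi0 eta0 exi eeta] := h 0%N; have [a1 xi1 eta1 _ _] := h 1%N.
exists (A 0 * x + y)%N, x; split; try nia.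
by rewrite natrD natrM (formval_step _ _ a0 a1 xi1 eta0 exi eeta).
Qed.

End Descent.

(** * Heights as Markov values *)

Section Markov.
Variable R : realType.

Lemma formval_ge_inv (A : nat -> nat) (X Y : nat -> R) m x y : chain A X Y -> 2 <= m ->
    (forall n, (A n)%:R + X n + Y n <= m) -> (0 < x)%N ->
  m^-1 <= formval (A 0%N) (X 0%N) (Y 0%N) x%:R y%:R.
Proof.
move=> h m2 hm x0; have [half|[n [e [e0 -> _]]]] := descent y h x0.
  by apply: le_trans half; rewrite div1r lef_pV2 ?posrE //; lra.
have [a0 xi0 eta0 _ _] := h n; have A0 : 0 < (A n)%:R :> R by rewrite ltr0n.
have L0 : 0 < (A n)%:R + X n + Y n by lra.
apply: (@le_trans _ _ ((A n)%:R + X n + Y n)^-1); first by rewrite lef_pV2 ?posrE //; lra.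
by rewrite ler_peMl ?invr_ge0 ?(ltW L0) // exprn_ege1 // ler1n.
Qed.

Lemma regular_chain (x : twosided R) i : (forall j, regular x j) ->
  chain (fun n => dig x (i + n%:Z)) (fun n => fwd x (i + n%:Z)) (fun n => bwd x (i + n%:Z)).
Proof.
move=> reg n; have [/andP[d1 _] /andP[f _] /andP[b _] ef _] := reg (i + n%:Z).
have [_ _ _ _ eb] := reg (i + n.+1%:Z).
have E1 : i + n%:Z + 1 = i + n.+1%:Z by lia.
have E2 : i + n.+1%:Z - 1 = i + n%:Z by lia.
by rewrite E1 in ef; rewrite E2 in eb; split=> //; lra.
Qed.

(** The form with roots [a_0; a_1, ...] and - [0; a_(-1), ...] takes the inverse of the height
    at (1, 0). A vector with entries of the same sign is handled by the descent along the
    forward tail, one with entries of opposite signs by the descent along the backward tail,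
    and both meet only values that are at least the inverse of the largest height. *)
Lemma lam_markov x : (forall j, regular x j) -> 2 <= lam x 0 ->
  (forall j, lam x j <= lam x 0) -> @markov_spectrum R (lam x 0).
Proof.
move=> reg D2 Dmax; have [/andP[d1 _] /andP[f _] /andP[b _] _ Eb] := reg 0.
have [/andP[d1' _] /andP[f' _] /andP[b' _] Ef' _] := reg (-1).
pose w := (dig x 0)%:R + fwd x 0; pose h := bwd x 0; pose D := w + h.
have d0 : 1 <= (dig x 0)%:R :> R by rewrite ler1n.
have d0' : 1 <= (dig x (-1))%:R :> R by rewrite ler1n.
have w0 : 0 < w by rewrite /w; lra.
have h0 : 0 < h by rewrite /h; lra.
have D0 : 0 < D by rewrite /D; lra.
have DE : lam x 0 = D by [].
have Q (u v : R) : qform D^-1 ((h - w) / D) (- (w * h) / D) u v = (u - w * v) * (u + h * v) / D.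
  by rewrite /qform; field; lra.
have right_ge (m n : nat) : (0 < m)%N -> D^-1 <= `|(m%:R - w * n%:R) * (m%:R + h * n%:R) / D|.
  move=> m0; have := formval_ge_inv n (regular_chain 0 reg) D2 _ m0.
  rewrite DE addr0 !normrM normfV (gtr0_norm D0) => /(_ (fun k => Dmax _)).
  rewrite /formval -/w -/h -/D [`|_ + h * _|]ger0_norm //.
  by rewrite addr_ge0 // mulr_ge0 // ltW.
have left_ge (m n : nat) : (0 < n)%N -> D^-1 <= `|(m%:R + w * n%:R) * (m%:R - h * n%:R) / D|.
  move=> n0.
  have mreg j : regular (mirror x) j by apply/regular_mirror/reg.
  have := formval_ge_inv m (regular_chain 1 mreg) D2 _ n0.
  have Dm k : lam (mirror x) (1 + k%:Z) <= lam x 0 by rewrite lam_mirror.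
  move=> /(_ Dm); rewrite DE /= addr0.
  have -> : `|(m%:R + w * n%:R) * (m%:R - h * n%:R) / D| =
            (m%:R + w * n%:R) * `|m%:R - h * n%:R| / D.
    rewrite !normrM normfV (gtr0_norm D0) [`|_ + w * _|]ger0_norm //.
    by rewrite addr_ge0 // mulr_ge0 // ltW.
  rewrite /formval; rewrite -/h sub0r in Eb; rewrite addNr -/w in Ef'.
  rewrite Ef' (_ : (dig x (-1))%:R + bwd x (-1) = h^-1); last by rewrite Eb invrK.
  have -> : n%:R - h^-1 * m%:R = - (m%:R - h * n%:R) / h by field; lra.
  rewrite normrM normrN normfV (gtr0_norm h0).
  have wh := mulr_gt0 w0 h0.
  by congr (_ <= _); rewrite /D; field; apply/and3P; split; lra.
have all_ge (u v : int) : (u, v) != (0, 0) ->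
    D^-1 <= `|qform D^-1 ((h - w) / D) (- (w * h) / D) u%:~R v%:~R|.
  have eq_ge (s t : R) : D^-1 <= `|s| -> s = t -> D^-1 <= `|t| by move=> + <-.
  rewrite Q; case: u v => m [] n uv; rewrite ?NegzE ?mulrNz /=.
  - have [m0|m0] := posnP m; last exact: right_ge.
    have n0 : (0 < n)%N by move: uv; rewrite m0; case: (n).
    by apply: eq_ge (left_ge 0%N n n0) _; rewrite m0; ring.
  - by apply: eq_ge (left_ge m n.+1 isT) _; ring.
  - have [n0|n0] := posnP n.
      by apply: eq_ge (right_ge m.+1 0%N isT) _; rewrite n0; ring.
    by apply: eq_ge (left_ge m.+1 n n0) _; ring.
  - by apply: eq_ge (right_ge m.+1 n.+1 isT) _; ring.
have one_in : [set `|qform D^-1 ((h - w) / D) (- (w * h) / D) xy.1%:~R xy.2%:~R|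
        | xy in [set xy : int * int | xy != (0, 0)]] D^-1.
  exists (1, 0) => //=; rewrite Q !mulr0 subr0 addr0 !mul1r gtr0_norm ?invr_gt0 //.
have E : qform_inf D^-1 ((h - w) / D) (- (w * h) / D) = D^-1.
  apply/eqP; rewrite eq_le /qform_inf; apply/andP; split.
    apply: ge_inf => //; exists D^-1 => _ [uv huv <-]; apply: all_ge.
    by case: uv huv.
  apply: lb_le_inf; first by exists D^-1.
  by move=> _ [[u v] huv <-]; apply: all_ge.
exists D^-1, ((h - w) / D), (- (w * h) / D); split.
- split; [exists 1, 0|exists 0, 1]; rewrite Q ?mulr0 ?mulr1 ?subr0 ?addr0 ?mul1r ?sub0r ?add0r.
    by rewrite invr_gt0.
  by rewrite mulNr mulNr oppr_lt0 divr_gt0 // mulr_gt0.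
- by rewrite /D; field; lra.
- by rewrite E invr_gt0.
- by rewrite E DE div1r invrK.
Qed.
End Markov.

(** * Lagrange values as limits of heights *)

Section Gauss.
Variables (R : realType) (alpha : R).
Hypothesis irr : irrational alpha.

Fixpoint gauss n : R :=
  if n is n'.+1 then (gauss n')^-1 - (Num.truncn (gauss n')^-1)%:R
  else alpha - (Num.floor alpha)%:~R.

(** [gauss n] is the n-th iterate of the Gauss map, so [quot n] is the partial quotient of index
    n + 1 of [alpha], and [past n] is the ratio of two consecutive denominators. *)
Definition quot n := Num.truncn (gauss n)^-1.
Fixpoint past n : R := if n is n'.+1 then ((quot n')%:R + past n')^-1 else 0.

Lemma gauss_irrational n : irrational (gauss n).
Proof.
elim: n => [|n IH] [q _ h].
  by apply: irr; exists (q + (Num.floor alpha)%:~R) => //; rewrite rmorphD /= ratr_int h subrK.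
apply: IH; exists (q + (quot n)%:R)^-1 => //.
by rewrite fmorphV rmorphD /= ratr_nat h subrK invrK.
Qed.

Lemma gauss_neq0 n : gauss n != 0.
Proof. by apply/eqP => g0; apply: (@gauss_irrational n); exists 0; rewrite // g0 rmorph0. Qed.

Lemma gauss_itv n : 0 < gauss n < 1.
Proof.
rewrite lt_neqAle eq_sym gauss_neq0 /=; elim: n => [|n /andP[g0 g1]] /=.
  by rewrite subr_ge0 floor_le ltrBlDr addrC -[1]/(1%:~R) -intrD floorD1_gt.
have /andP[t1 t2] : (Num.truncn (gauss n)^-1)%:R <= (gauss n)^-1 < (Num.truncn (gauss n)^-1).+1%:R.
  by rewrite truncn_itv // invr_ge0.
by rewrite subr_ge0 t1 /= ltrBlDr addrC natr1.
Qed.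

Lemma gauss_gt0 n : 0 < gauss n. Proof. by case/andP: (gauss_itv n). Qed.
Lemma gauss_lt1 n : gauss n < 1. Proof. by case/andP: (gauss_itv n). Qed.

Lemma quot_gt0 n : (0 < quot n)%N.
Proof. by rewrite /quot truncn_gt0 invr_ge1 ?unitfE ?gauss_neq0 ?gauss_gt0 ?ltW ?gauss_lt1. Qed.

Lemma gaussE n : gauss n = ((quot n)%:R + gauss n.+1)^-1.
Proof. by rewrite /= addrC subrK invrK. Qed.

Lemma past_ge0 n : 0 <= past n.
Proof. by elim: n => //= n IH; rewrite invr_ge0 addr_ge0. Qed.

Lemma past_le1 n : past n <= 1.
Proof.
case: n => //= n; have h := past_ge0 n; have q : 1 <= (quot n)%:R :> R by rewrite ler1n quot_gt0.
by rewrite invf_le1; lra.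
Qed.

Lemma gauss_chain : chain quot (fun n => gauss n.+1) past.
Proof.
move=> n; split=> //; [exact: quot_gt0|exact: gauss_gt0|exact: past_ge0|exact: gaussE].
Qed.

Definition gauss_lam n : R := (quot n)%:R + gauss n.+1 + past n.

(** q (q alpha - p) is, up to sign, the form at level zero whose second root is at infinity; one
    substitution brings that root to 0, which is [past 0]. *)
Lemma approximationE (q y : nat) : (0 < q)%N ->
  `|q%:R * (q%:R * alpha - ((Num.floor alpha)%:~R * q%:R + y%:R))| =
  formval (quot 0) (gauss 1) (past 0) q%:R y%:R.
Proof.
move=> q0; rewrite /formval /= mul0r !addr0.
set T := Num.truncn _; rewrite (_ : T%:R + _ = (gauss 0)^-1); last by rewrite /= addrC subrK.
have g0 := gauss_gt0 0; have Q0 : 0 < q%:R :> R by rewrite ltr0n.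
have -> : q%:R * alpha - ((Num.floor alpha)%:~R * q%:R + y%:R) =
          gauss 0 * (q%:R - (gauss 0)^-1 * y%:R).
  by rewrite mulrBr mulVKf ?gauss_neq0 //= ; ring.
rewrite !normrM (gtr0_norm g0) (gtr0_norm Q0) invrK; ring.
Qed.

Section Value.
Variables (c lo hi : R).
Hypothesis val_c : lagrange_value alpha = c%:E.
Hypotheses (lo_c : lo < c) (c_hi : c < hi) (lo2 : 2 < lo) (hi4 : hi < 4).

(** Late convergents are among the pairs (p, q) that are allowed in the limsup, and their values
    are the heights. *)
Lemma gauss_lam_eventually : exists n0, forall n, (n0 <= n)%N -> gauss_lam n < hi.
Proof.
have : (lagrange_value alpha < hi%:E)%E by rewrite val_c lte_fin.
case/ereal_inf_lt => _ [N _ <-] hN.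
have a0 : alpha != 0.
  by apply/eqP => a0; apply: irr; exists 0; rewrite // a0 rmorph0.
have aa : 0 < `|alpha| by rewrite normr_gt0.
(* If q is at least (N + 1) / |alpha|, then p, at distance at most 1 from q alpha, is at least N. *)
pose M := (N + (Num.truncn (N.+1%:R / `|alpha|)).+1)%N.
exists (2 * M)%N => n nM.
have [q [y [q0 yq nqy e]]] := ascent n gauss_chain.
have g0 : 0 < gauss_lam n.
  have := gauss_gt0 n.+1; have := past_ge0 n; rewrite /gauss_lam.
  by have : 0 <= (quot n)%:R :> R by []; lra.
pose p := (Num.floor alpha) * q%:Z + y%:Z.
have E : `|q%:Z%:~R * (q%:Z%:~R * alpha - p%:~R)| = (gauss_lam n)^-1 :> R.
  by rewrite -e /= -(approximationE _ q0) /p intrD intrM.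
have qM : (M <= q)%N by lia.
have Q0 : 1 <= q%:R :> R by rewrite ler1n.
have g1 : 1 <= gauss_lam n.
  have := gauss_gt0 n.+1; have := past_ge0 n; rewrite /gauss_lam.
  by have : 1 <= (quot n)%:R :> R; [rewrite ler1n quot_gt0|lra].
have pN : (N <= `|p|)%N.
  rewrite -(ler_nat R) natr_absz intr_norm.
  have : `|q%:R * alpha - p%:~R| <= 1.
    have : q%:R * `|q%:R * alpha - p%:~R| <= 1.
      rewrite -[X in X * _]ger0_norm // -normrM E invf_le1 //.
    by apply: le_trans; rewrite ler_peMl.
  move=> h1; have h2 : `|q%:R * alpha| <= `|p%:~R| + 1.
    by rewrite -[X in `|X|](subrK p%:~R) (le_trans (ler_normD _ _)) // addrC lerD2l.
  have : N.+1%:R <= q%:R * `|alpha|.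
    rewrite -ler_pdivrMr //; apply: le_trans (ltW (truncnS_gt _)) _; rewrite ler_nat.
    by apply: leq_trans qM; rewrite /M leq_addl.
  rewrite normrM ger0_norm // in h2; rewrite -natr1; lra.
have qN : (N <= `|q%:Z|)%N by apply: leq_trans qM; rewrite /M leq_addr.
rewrite -lte_fin -[gauss_lam n]invrK -E -div1r; apply: le_lt_trans hN.
by apply: ereal_sup_ubound; exists (p, q%:Z).
Qed.

Lemma gauss_bounds n0 n : (forall n, (n0 <= n)%N -> gauss_lam n < hi) -> (n0 + 2 <= n)%N ->
  [/\ (1 <= quot n <= 3)%N, 1 / 4 <= gauss n.+1 <= 4 / 5 & 1 / 4 <= past n <= 4 / 5].
Proof.
move=> h.
have d k : (n0 <= k)%N -> (1 <= quot k <= 3)%N.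
  move=> /h; rewrite quot_gt0 /= /gauss_lam -ltnS -(ltr_nat R).
  have := gauss_gt0 k.+1; have := past_ge0 k.
  by move: (gauss k.+1) (past k) => g p *; apply: lt_trans hi4; lra.
have dR k : (n0 <= k)%N -> 1 <= ((quot k)%:R : R) <= 3.
  by move=> /d; rewrite ler1n (ler_nat R _ 3).
have inv4 (u v : R) : 1 <= u <= 3 -> 0 <= v <= 1 -> 1 / 4 <= (u + v)^-1.
  by move=> hu hv; rewrite div1r lef_pV2 ?posrE; lra.
have inv5 (u v : R) : 1 <= u <= 3 -> 1 / 4 <= v -> (u + v)^-1 <= 4 / 5.
  move=> hu hv; rewrite (_ : 4 / 5 = (5 / 4)^-1); last by rewrite invf_div.
  by rewrite lef_pV2 ?posrE; lra.
have g4 k : (n0 <= k)%N -> 1 / 4 <= gauss k.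
  by move=> /dR hk; rewrite gaussE inv4 // ?(ltW (gauss_gt0 _)) ?(ltW (gauss_lt1 _)).
have p4 k : (n0 <= k)%N -> 1 / 4 <= past k.+1.
  by move=> /dR hk /=; rewrite inv4 // past_ge0 past_le1.
case: n => [|[|n]] hn; [lia|lia|].
split; first by apply: d; lia.
  rewrite g4; last lia.
  by rewrite [X in X <= _]gaussE inv5 ?dR ?g4 //; lia.
rewrite p4; last lia.
by rewrite /= -[X in _ + X]/(past n.+1) inv5 ?dR ?p4 //; lia.
Qed.

(** Pairs with a value above 2 are multiples of convergents. The multiple e of a convergent has
    its value divided by e^2, so for a convergent of small index only finitely many multiples
    have a value above [lo]: large pairs of large value come from late convergents. *)
Lemma gauss_lam_frequently n0 : (forall n, (n0 <= n)%N -> gauss_lam n < hi) ->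
  forall K, exists2 n, (K <= n)%N & lo <= gauss_lam n.
Proof.
move=> h K; apply: contrapT => no.
have small n : (K <= n)%N -> gauss_lam n < lo.
  by move=> Kn; rewrite ltNge; apply/negP => le; apply: no; exists n.
(* M bounds both the products of [descent] and the heights for the levels below K. *)
pose P := (\prod_(k < K) (quot k).+1)%N; pose M := (3 * P)%N.
have P0 : (0 < P)%N by rewrite prodn_gt0.
have prod_le n : (n <= K)%N -> (\prod_(k < n) (quot k).+1 <= P)%N.
  rewrite /P -!(big_mkord xpredT (fun k => (quot k).+1)) => nK.
  by rewrite (big_cat_nat (leq0n n) nK) //= leq_pmulr // prodn_gt0.
have lam_le n : (n < K)%N -> gauss_lam n <= M%:R.
  move=> nK; have q1 : ((quot n).+1 <= P)%N.
    apply: leq_trans (prod_le _ nK); rewrite big_ord_recr /=.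
    by rewrite leq_pmull // prodn_gt0.
  have : (quot n).+2%:R <= M%:R :> R by rewrite ler_nat /M; lia.
  have := gauss_lt1 n.+1; have := past_le1 n; rewrite -!natr1 /gauss_lam; lra.
have : (lo%:E < lagrange_value alpha)%E by rewrite val_c lte_fin.
move/lt_le_trans/(_ (ereal_inf_lbound (ex_intro2 _ _ (M * M)%N I erefl))).
case/ereal_sup_gt => _ [[p q] /= [pN qN] <-]; rewrite lte_fin.
wlog q0 : p q pN qN / 0 < q.
  move=> H; case: (ltgtP q 0) qN => [qneg|qpos|->] qN.
  - move=> hl; apply: (H (- p) (- q)); rewrite ?abszN ?oppr_gt0 //.
    rewrite (_ : (- q)%:~R * _ = q%:~R * (q%:~R * alpha - p%:~R)) //.
    by rewrite !mulrNz; ring.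
  - exact: H.
  - by rewrite /M in qN; lia.
case: q q0 qN => // q q0 qN.
pose y := p - Num.floor alpha * q%:Z.
have pE : p%:~R = (Num.floor alpha)%:~R * q%:R + y%:~R :> R.
  by rewrite /y intrD rmorphN /= intrM addrC subrK.
have Q1 : 1 <= q%:R :> R by rewrite ler1n.
have lo1 : 1 <= lo by apply: le_trans (ltW lo2); rewrite ler1n.
have [y0|y0] := ltP y 0.
  rewrite pE ltNge => /negP[]; apply: (@le_trans _ _ 1) lo1.
  have Y1 : y%:~R <= -1 :> R by rewrite -[-1]/((-1)%:~R) ler_int; lia.
  have F1 : 1 <= q%:R * alpha - ((Num.floor alpha)%:~R * q%:R + y%:~R).
    have : 0 <= (alpha - (Num.floor alpha)%:~R) * q%:R.
      by rewrite mulr_ge0 // subr_ge0 floor_le.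
    rewrite mulrBl [q%:R * alpha]mulrC; move: (alpha * _) (_ * q%:R) (y%:~R : R) Y1 => u v z *.
    lra.
  have F2 : 1 <= `|q%:R * (q%:R * alpha - ((Num.floor alpha)%:~R * q%:R + y%:~R))|.
    rewrite normrM [`|q%:R|]ger0_norm // -[X in X <= _]mulr1 ler_pM //.
    by apply: le_trans F1 _; exact: ler_norm.
  by rewrite div1r invf_le1 // (lt_le_trans _ F2).
case: y y0 pE => // y y0 pE; rewrite pE approximationE // => val_gt.
have [half|[n [e [e0 E le]]]] := descent y gauss_chain (q0 : (0 < q)%N).
  move: val_gt; rewrite ltNge => /negP[]; apply: (@le_trans _ _ 2); last exact: ltW.
  rewrite div1r (_ : 2 = (1 / 2)^-1); last by rewrite invf_div divr1.
  by rewrite lef_pV2 // posrE; lra.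
have g0 : 0 < gauss_lam n.
  have := gauss_gt0 n.+1; have := past_ge0 n; rewrite /gauss_lam.
  by have : 1 <= (quot n)%:R :> R; [rewrite ler1n quot_gt0|lra].
have E1 : 1 <= e%:R :> R by rewrite ler1n.
move: val_gt; rewrite E -/(gauss_lam n) invf_div mul1r ltr_pdivlMr ?exprn_gt0 ?ltr0n // => lt_e.
have [Kn|nK] := leqP K n.
  have := small _ Kn; have : lo * 1 <= lo * e%:R ^+ 2 by rewrite ler_pM2l ?exprn_ege1 //; lra.
  lra.
have eM : (M <= e)%N.
  have : (M * M <= e * M)%N.
    apply: leq_trans qN _; apply: leq_trans (leq_addr y q) _; apply: leq_trans le _.
    by rewrite leq_mul2l (leq_trans (prod_le _ (ltnW nK))) ?orbT // /M; lia.
  by rewrite leq_pmul2r // /M; lia.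
have M1 : 1 <= M%:R :> R by rewrite ler1n /M; lia.
have : M%:R <= e%:R :> R by rewrite ler_nat.
have := lam_le _ nK; rewrite expr2 in lt_e *.
move: (M%:R) (e%:R : R) (gauss_lam n) M1 E1 lt_e => m e' g M1 E1 lt_e h1 h2.
have h3 : e' * 1 <= e' * (lo * e') by rewrite ler_pM2l ?mulr_ege1 //; lra.
by move: lt_e; rewrite mulrCA ltNge (le_trans h1) // (le_trans h2) // -[leLHS]mulr1.
Qed.

Lemma regular_tail : exists x : twosided R, exists n1 : int,
  (forall j, n1 <= j -> regular x j /\ lam x j <= hi) /\
  (forall N : int, exists2 i, N <= i & lo <= lam x i).
Proof.
have [n0 h] := gauss_lam_eventually.
exists (TwoSided (fun j => quot `|j|) (fun j => gauss `|j|.+1) (fun j => past `|j|)).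
exists (n0 + 3)%N%:Z; split=> [j hj|N].
  case: j hj => // n hn; have n2 : (n0 + 2 <= n)%N by lia.
  have [h1 h2 h3] := gauss_bounds h n2.
  split; last by apply/ltW/h; lia.
  split=> //=.
    by rewrite addn1; exact: (gaussE n.+1).
  case: n n2 hn h1 h2 h3 => [|n] *; first by lia.
  by rewrite /= ?subn1 ?subSS ?subn0.
have [n nN hn] := gauss_lam_frequently h `|N|%N.
exists n%:Z => //; lia.
Qed.
End Value.
End Gauss.

(** * Infinite continued fractions *)

Section Infinite.
Variable R : realType.
Implicit Types (s : nat -> nat).

Definition shift s n := s n.+1.

(** The convergents of even index increase, so their limit is a supremum; that the convergents of
    odd index have the same limit is the vanishing of [parity_gap] below. *)
Fixpoint even_conv s n : R :=
  if n is n'.+1 then ((s 0%N)%:R + ((s 1%N)%:R + even_conv (shift (shift s)) n')^-1)^-1 else 0.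
Definition cfval s : R := sup (range (even_conv s)).
Definition small_digits s := forall n, (1 <= s n <= 3)%N.

Lemma shift_small s : small_digits s -> small_digits (shift s).
Proof. by move=> h n; apply: h. Qed.

Lemma digit_itv s n : small_digits s -> 1 <= ((s n)%:R : R) <= 3.
Proof. by move=> /(_ n); rewrite ler1n (ler_nat R _ 3). Qed.

Lemma inv_itv (u v : R) : 1 <= u <= 3 -> 0 <= v <= 1 -> 1 / 4 <= (u + v)^-1 <= 1.
Proof.
move=> hu hv; apply/andP; split; last by rewrite invf_le1; lra.
by rewrite div1r lef_pV2 ?posrE; lra.
Qed.

Lemma even_conv_itv s n : small_digits s -> 0 <= even_conv s n <= 1.
Proof.
elim: n s => [|n IH] s h /=; first by rewrite lexx ler01.
have /andP[a1 a2] := inv_itv (digit_itv 1 h) (IH _ (shift_small (shift_small h))).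
have a : 0 <= ((s 1%N)%:R + even_conv (shift (shift s)) n)^-1 <= 1.
  by rewrite a2 (le_trans _ a1).
have /andP[b1 ->] := inv_itv (digit_itv 0 h) a.
by rewrite (le_trans _ b1).
Qed.

Lemma even_conv_nondecreasing s : small_digits s -> nondecreasing_seq (even_conv s).
Proof.
move=> h; apply/nondecreasing_seqP => n; elim: n s h => [|n IH] s h.
  by have /andP[] := even_conv_itv 1 h.
have h2 := shift_small (shift_small h).
have := IH _ h2; have /andP[+ _] := even_conv_itv n h2.
have := digit_itv 0 h; have := digit_itv 1 h.
rewrite [even_conv s n.+2]/= -/(even_conv (shift (shift s)) n.+1) [even_conv s n.+1]/=.
move: (even_conv (shift (shift s)) n) (even_conv (shift (shift s)) n.+1) => u v h1 h0 u0 uv.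
have i1 : 0 < ((s 1%N)%:R + v)^-1 by rewrite invr_gt0; lra.
have i2 : ((s 1%N)%:R + v)^-1 <= ((s 1%N)%:R + u)^-1 by rewrite lef_pV2 ?posrE; lra.
by rewrite lef_pV2 ?posrE; lra.
Qed.

Lemma even_conv_cvg s : small_digits s -> even_conv s @ \oo --> cfval s.
Proof.
move=> h; apply: nondecreasing_cvgn; first exact: even_conv_nondecreasing.
by exists 1 => _ [n _ <-]; have /andP[] := even_conv_itv n h.
Qed.

Lemma cfval_step2 s : small_digits s ->
  cfval s = ((s 0%N)%:R + ((s 1%N)%:R + cfval (shift (shift s)))^-1)^-1.
Proof.
move=> h; have h2 := shift_small (shift_small h).
have c := even_conv_cvg h2.
have v0 : 0 <= cfval (shift (shift s)).
  rewrite -(cvg_lim (@Rhausdorff R) c); apply: limr_ge; first exact: cvgP c.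
  by apply: nearW => n; have /andP[] := even_conv_itv n h2.
have /andP[d0 _] := digit_itv 0 h; have /andP[d1 _] := digit_itv 1 h.
have i1 : 0 < ((s 1%N)%:R + cfval (shift (shift s)))^-1 by rewrite invr_gt0; lra.
have := even_conv_cvg h; rewrite -(cvg_shiftS (even_conv s)).
move/cvg_unique; apply => //=.
apply: cvgV; first by apply: lt0r_neq0; lra.
apply: cvgD; first exact: cvg_cst.
apply: cvgV; first by apply: lt0r_neq0; lra.
by apply: cvgD; [exact: cvg_cst|exact: c].
Qed.

Lemma cfval_itv s : small_digits s -> 1 / 4 <= cfval s <= 4 / 5.
Proof.
move=> h; have c := even_conv_cvg (shift_small (shift_small h)).
have vitv : 0 <= cfval (shift (shift s)) <= 1.
  rewrite -(cvg_lim (@Rhausdorff R) c); apply/andP; split.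
    apply: limr_ge; first exact: cvgP c.
    by apply: nearW => n; have /andP[] := even_conv_itv n (shift_small (shift_small h)).
  apply: limr_le; first exact: cvgP c.
  by apply: nearW => n; have /andP[] := even_conv_itv n (shift_small (shift_small h)).
rewrite cfval_step2 //.
have /andP[a1 a2] := inv_itv (digit_itv 1 h) vitv.
have a : 0 <= ((s 1%N)%:R + cfval (shift (shift s)))^-1 <= 1 by rewrite a2 (le_trans _ a1).
have /andP[-> _] /= := inv_itv (digit_itv 0 h) a.
have := digit_itv 0 h; move: (s 0%N)%:R ((s 1%N)%:R + cfval (shift (shift s)))^-1 a1 => d w w4 hd.
by rewrite -[4 / 5]invf_div lef_pV2 ?posrE; lra.
Qed.

Definition parity_gap s : R := `|cfval s - ((s 0%N)%:R + cfval (shift s))^-1|.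

(** The factor is the square of 4/5, the largest value of a tail. *)
Lemma parity_gap_shift s : small_digits s -> parity_gap s <= 16 / 25 * parity_gap (shift s).
Proof.
move=> h; have h1 := shift_small h; have h2 := shift_small h1.
rewrite /parity_gap {1}(cfval_step2 h).
have := digit_itv 0 h; have := cfval_itv h1.
have : 1 / 4 <= ((s 1%N)%:R + cfval (shift (shift s)))^-1.
  have vi : 0 <= cfval (shift (shift s)) <= 1 by have := cfval_itv h2; lra.
  by have /andP[] := inv_itv (digit_itv 1 h) vi.
rewrite -[(shift s) 0%N]/(s 1%N).
move: (s 0%N)%:R (cfval (shift s)) ((s 1%N)%:R + _)^-1 => d u v v4 hu hd.
have -> : (d + v)^-1 - (d + u)^-1 = ((d + v) * (d + u))^-1 * (u - v).
  by field; apply/andP; split; lra.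
rewrite normrM ler_wpM2r // gtr0_norm ?invr_gt0 ?mulr_gt0; try lra.
by rewrite -[16 / 25]invf_div lef_pV2 ?posrE; nra.
Qed.

(** Iterating the contraction bounds n times the gap by 2 for every n. *)
Lemma parity_gap0 s : small_digits s -> parity_gap s = 0.
Proof.
have bound n s' : small_digits s' -> parity_gap s' * n%:R <= 2.
  elim: n s' => [|n IH] s' h; first by rewrite mulr0.
  have h1 := shift_small h.
  have g1 k : small_digits k -> parity_gap k <= 1.
    move=> hk; have hu := cfval_itv hk.
    have vi : 0 <= cfval (shift k) <= 1 by have := cfval_itv (shift_small hk); lra.
    by have hw := inv_itv (digit_itv 0 hk) vi; rewrite /parity_gap ler_norml; lra.
  have g0 : 0 <= parity_gap (shift s') by rewrite normr_ge0.
  have := parity_gap_shift h; have := IH _ h1; have := g1 _ h.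
  case: n {IH} => [|[|n]]; [lra|lra|].
  have -> : n.+3%:R = n%:R + 3 :> R by rewrite -addn3 natrD.
  have -> : n.+2%:R = n%:R + 2 :> R by rewrite -addn2 natrD.
  have : 0 <= n%:R :> R by [].
  move: (n%:R) (parity_gap (shift s')) (parity_gap s') g0 => m g g' g0 m0 g1' h2 h3.
  have : 0 <= g * m by rewrite mulr_ge0.
  have : 0 <= (16 / 25 * g - g') * (m + 3) by rewrite mulr_ge0; lra.
  lra.
move=> h; apply/eqP; rewrite eq_le normr_ge0 andbT leNgt; apply/negP => g0.
have := bound (Num.truncn (2 / parity_gap s)).+1 _ h; apply/negP; rewrite -ltNge.
by rewrite mulrC -ltr_pdivrMr // truncnS_gt.
Qed.

Lemma cfvalE s : small_digits s -> cfval s = ((s 0%N)%:R + cfval (shift s))^-1.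
Proof. by move=> /parity_gap0 /eqP; rewrite normr_eq0 subr_eq0 => /eqP. Qed.
End Infinite.

(** * Distances between continued fractions with a common beginning *)

Section Separation.
Variable R : realFieldType.

Definition small_seq s := all (fun a => 1 <= a <= 3)%N s.

Lemma cfr_itv s (v : R) : small_seq s -> 0 <= v <= 1 -> 0 <= cfr s v <= 1.
Proof.
move=> + hv; elim: s => //= a s IH /andP[/andP[a1 _] /IH].
have A1 : 1 <= a%:R :> R by rewrite ler1n.
move: (cfr s v) => w hw.
by rewrite invr_ge0 invf_le1; lra.
Qed.

(** Each step t |-> 1/(a + t) with a at most 3 contracts distances by a factor at least 1/16. *)
Lemma cfr_sep s (t u : R) : small_seq s -> 0 <= t <= 1 -> 0 <= u <= 1 ->
  (1 / 16) ^+ size s * `|t - u| <= `|cfr s t - cfr s u|.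
Proof.
move=> + ht hu; elim: s => [|a s IH] hs /=; first by rewrite expr0 mul1r.
have /= /andP[/andP[a1 a3] hs'] := hs.
have := cfr_itv hs' ht; have := cfr_itv hs' hu; have {IH} := IH hs'.
have A1 : 1 <= a%:R :> R by rewrite ler1n.
have A3 : a%:R <= 3 :> R by rewrite (ler_nat R _ 3).
have k0 : 0 <= (1 / 16 : R) ^+ size s by rewrite exprn_ge0 //; lra.
rewrite exprS; move: (_ ^+ _) k0 => k k0; move: (cfr s t) (cfr s u) => v w h hw hv.
have -> : (a%:R + v)^-1 - (a%:R + w)^-1 = - ((a%:R + v) * (a%:R + w))^-1 * (v - w).
  by field; apply/andP; split; lra.
rewrite -mulrA normrM normrN; apply: ler_pM => //; first by rewrite mulr_ge0.
rewrite gtr0_norm; last by rewrite invr_gt0 mulr_gt0; lra.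
by rewrite div1r lef_pV2 ?posrE; nra.
Qed.

(** Numerator and denominator of [0; s + t] as polynomials in t, that is, continuants. *)
Fixpoint cfden s (t : R) : R * R :=
  if s is a :: s' then ((cfden s' t).2, a%:R * (cfden s' t).2 + (cfden s' t).1) else (t, 1).

Lemma cfden_gt0 s t : 0 < t -> 0 < (cfden s t).1 /\ 0 < (cfden s t).2.
Proof.
by move=> t0; elim: s => [|a s [h1 h2]] //=; split=> //; rewrite ltr_wpDl ?mulr_ge0 // ltW.
Qed.

Lemma cfr_den s t : 0 < t -> cfr s t = (cfden s t).1 / (cfden s t).2.
Proof.
move=> t0; elim: s => [|a s /= ->] /=; first by rewrite divr1.
have [h1 h2] := cfden_gt0 s t0.
have : 0 <= a%:R :> R by [].
move: (cfden s t) h1 h2 => [p q] /= *.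
by field; apply/andP; split; nra.
Qed.

Lemma cfden_det s t u :
  `|(cfden s t).1 * (cfden s u).2 - (cfden s u).1 * (cfden s t).2| = `|t - u|.
Proof.
elim: s => [|a s <-] /=; first by rewrite !mulr1.
by rewrite [RHS]distrC; congr `|_|; ring.
Qed.

(** Denominators of words in 1 and 2 grow like (1 + sqrt 2)^n at most. The rational 5/2 is above
    1 + sqrt 2 because 2 (5/2) + 1 <= (5/2)^2. *)
Lemma cfden_le s t : all (fun a => a <= 2)%N s -> 0 < t <= 1 ->
  (cfden s t).1 <= (5 / 2) ^+ size s /\ (cfden s t).2 <= (5 / 2) ^+ (size s).+1.
Proof.
move=> + /andP[t0 t1]; elim: s => [|a s IH] /=.
  by rewrite expr0 expr1; split=> //; lra.
move=> /andP[a2 /IH[h1 h2]]; split=> //; rewrite !exprS in h2 *.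
have [p1 p2] := cfden_gt0 s t0.
have A2 : a%:R <= 2 :> R by rewrite (ler_nat R _ 2).
have A0 : 0 <= a%:R :> R by [].
move: (_ ^+ _) (cfden s t) h1 h2 p1 p2 => k [p q] /= *; nra.
Qed.

(** Two continued fractions with the same n first digits differ by |t - u| divided by the product
    of their continuants. *)
Lemma cfr_sep_small s (t u : R) : all (fun a => a <= 2)%N s -> 0 < t <= 1 -> 0 < u <= 1 ->
  (4 / 25) ^+ (size s).+1 * `|t - u| <= `|cfr s t - cfr s u|.
Proof.
move=> hs ht hu; have /andP[t0 _] := ht; have /andP[u0 _] := hu.
rewrite !cfr_den // -(cfden_det s t u).
have [h1 h2] := cfden_gt0 s t0; have [h3 h4] := cfden_gt0 s u0.
have [_] := cfden_le hs ht; have [_] := cfden_le hs hu.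
move: (cfden s t) (cfden s u) h1 h2 h3 h4 => [p q] [p' q'] /= h1 h2 h3 h4 l1 l2.
have -> : p / q - p' / q' = (q * q')^-1 * (p * q' - p' * q).
  by field; apply/andP; split; lra.
rewrite normrM ler_wpM2r // gtr0_norm ?invr_gt0 ?mulr_gt0 //.
have -> : 4 / 25 = ((5 / 2) * (5 / 2))^-1 :> R by field.
rewrite exprVn lef_pV2 ?posrE ?exprn_gt0 ?mulr_gt0 //; try lra.
by rewrite exprMn ler_pM // ltW.
Qed.
End Separation.

(** * The family of words and its heights *)

Lemma size_rdigits d i k : size (rdigits d i k) = k.
Proof. by elim: k i => //= k IH i; rewrite IH. Qed.

Lemma all_rdigits (P : pred nat) d i k :
  (forall t : int, 1 <= t <= k%:Z -> P (d (i + t))) -> all P (rdigits d i k).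
Proof.
elim: k i => //= k IH i h; rewrite h //= IH // => t ht.
by rewrite -addrA; apply: h; lia.
Qed.

Section Family.
Variable R : realType.

Definition free_digit (b : bool) : nat := if b then 1%N else 2%N.

(** The periodic word, left after position 12: there follow 2 1 2 1 2, which brings the height at
    0 into the window, and then the free digits coded by [b]. *)
Definition word (b : nat -> bool) (j : int) : nat :=
  if j is Posz n then
    if (n <= 12)%N then period_digit j else
    nth (free_digit (b (n - 18)%N)) [:: 2; 1; 2; 1; 2]%N (n - 13)
  else period_digit j.

Lemma wordL b (j : int) : j <= 12 -> word b j = period_digit j.
Proof. by case: j => //= n hn; rewrite ifT //; lia. Qed.

Lemma wordR b (k : nat) : word b (18%:Z + k%:Z) = free_digit (b k).
Proof. by rewrite /word /= nth_nil addKn. Qed.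

Lemma period_digit_small (j : int) : (1 <= period_digit j <= 3)%N.
Proof.
rewrite /period_digit; have : (`|(j %% 7)%Z|%N < 7)%N by lia.
by case: (absz _) => [|[|[|[|[|[|[|k]]]]]]].
Qed.

Lemma word_small b j : (1 <= word b j <= 3)%N.
Proof.
have [j12|j12] := leP j 12; first by rewrite wordL // period_digit_small.
have [j18|j18] := ltP j 18.
  case: j j12 j18 => // n j12 j18.
  have : n \in iota 13 5 by rewrite mem_iota; lia.
  by rewrite !inE => /or4P[|||/orP[]] /eqP->.
by rewrite -(subrKC 18 j) (_ : j - 18 = `|(j - 18)%R|%N%:Z) ?wordR; [case: (b _)|lia].
Qed.

Definition word_cf b : twosided R :=
  TwoSided (word b) (fun j => cfval R (fun k => word b (j + 1 + k%:Z)))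
                    (fun j => cfval R (fun k => word b (j - 1 - k%:Z))).

Lemma word_regular b j : regular (word_cf b) j.
Proof.
have sf i : small_digits (fun k => word b (i + 1 + k%:Z)) by move=> k; apply: word_small.
have sb i : small_digits (fun k => word b (i - 1 - k%:Z)) by move=> k; apply: word_small.
split; rewrite /= ?cfval_itv ?word_small //.
  rewrite cfvalE // addr0; congr ((_ + cfval R _)^-1).
  by apply/funext => k; rewrite /shift; congr word; lia.
rewrite cfvalE // subr0; congr ((_ + cfval R _)^-1).
by apply/funext => k; rewrite /shift; congr word; lia.
Qed.

Definition family_value b : R := lam (word_cf b) 0.

Definition family_right := rdigits period_digit 0 12 ++ [:: 2; 1; 2; 1; 2]%N.

Lemma family_value_itv b : frac_val R height_lo < family_value b < frac_val R height_hi.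
Proof.
have reg j : 0 - 20%:Z <= j <= 0 + 17%:Z -> regular (word_cf b) j.
  by move=> _; apply: word_regular.
have eL : ldigits (dig (word_cf b)) 0 20 = ldigits period_digit 0 20 by [].
have eR : rdigits (dig (word_cf b)) 0 17 = family_right by [].
apply/andP; split.
  by apply: (lam_above reg) => //; rewrite eL eR; vm_compute.
by apply: (lam_below reg) => //; rewrite eL eR; vm_compute.
Qed.

(** Far to the left the word is periodic, far to the right its digits are at most 2 and its heights
    at most 3.6; the 24 remaining positions are computed. *)
Lemma lam_other b (j : int) : j != 0 -> lam (word_cf b) j < frac_val R height_lo.
Proof.
move=> j0; have reg k : regular (word_cf b) k by apply: word_regular.
have [j8|j8] := leP j (-8).
  rewrite -[j]add0r; apply: (@lam_periodic R _ 0 (`|j| + 20) 12) => //; last lia.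
  by move=> t ht; rewrite add0r /= wordL //; lia.
have [j17|j17] := leP j 17.
  (* Positions are shifted by 7; position 0 itself is excepted. *)
  have check : all (fun n : nat => (n == 7%N) ||
     surely_below height_lo (ldigits (word b) (n%:Z - 7) 20) (word b (n%:Z - 7))
         (rdigits (word b) (n%:Z - 7) (24 - n))) (iota 0 25).
    by vm_compute.
  pose n := `|(j + 7)%R|%N; have nj : n%:Z - 7 = j by rewrite /n; lia.
  have /allP/(_ n) := check; rewrite mem_iota nj => /(_ _)/orP[]; first by rewrite /n; lia.
    by move/eqP => n7; move: j0; rewrite -nj n7.
  exact: (@lam_below R (word_cf b) j 20 (24 - n) (fun k _ => reg k) height_lo isT).
have d2 : (word b j <= 2)%N.
  by rewrite -(subrKC 18 j) (_ : j - 18 = `|(j - 18)%R|%N%:Z) ?wordR; [case: (b _)|lia].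
have [_ f g _ _] := reg j; have := height_lo_gt R.
have : (word b j)%:R <= 2 :> R by rewrite (ler_nat R _ 2).
by rewrite /lam; lra.
Qed.

Lemma family_markov b : @markov_spectrum R (family_value b).
Proof.
have /andP[lo _] := family_value_itv b; have lo' := height_lo_gt R.
apply: lam_markov; first exact: word_regular.
  by rewrite -/(family_value b); lra.
move=> j; have [->|j0] := eqVneq j 0; first exact: lexx.
by apply/ltW/(lt_trans (lam_other b j0)).
Qed.

Lemma family_not_lagrange b : ~ @lagrange_spectrum R (family_value b).
Proof.
move=> [alpha irr val]; have /andP[lo hi] := family_value_itv b.
have [x [n1 [dom rec]]] := regular_tail irr val lo hi (height_lo_gt2 R) (height_hi_lt R).
exact: (recurrent_absurd dom rec).
Qed.

Lemma fwd_word_itv b (j : int) : 0 < fwd (word_cf b) j <= 1.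
Proof. by have [_ h _ _ _] := word_regular b j; lra. Qed.

(** Two words of the family have the same digits up to the first free digit that differs, and the
    backward tails at 0 are equal. Where the digits 1 and 2 meet, the tails are on either side
    of the interval (4/9, 5/9). *)
Lemma family_sep b b' n : (forall k, (k < n)%N -> b k = b' k) -> b n != b' n ->
  (1 / 16) ^+ 17 * ((4 / 25) ^+ n.+1 * (1 / 9)) <= `|family_value b - family_value b'|.
Proof.
move=> eqb neqb; pose x := word_cf b; pose x' := word_cf b'.
have reg c (i : int) k j : i <= j < i + k%:Z -> regular (word_cf c) j.
  by move=> _; apply: word_regular.
have eqbwd : bwd x 0 = bwd x' 0.
  by congr (cfval R _); apply/funext => k /=; rewrite !wordL //; lia.
have -> : family_value b - family_value b' = fwd x 0 - fwd x' 0.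
  by rewrite /family_value /lam -/x -/x' eqbwd /=; ring.
have eqR : rdigits (dig x) 17 n = rdigits (dig x') 17 n.
  apply/eq_rdigitsP => t ht.
  have -> : 17 + t = 18%:Z + `|(t - 1)%R|%N%:Z by lia.
  by rewrite [dig x _]wordR [dig x' _]wordR eqb //; lia.
rewrite (fwd_cfr (reg b 0 17%N)) (fwd_cfr (reg b' 0 17%N)) -/x -/x'.
rewrite (_ : rdigits (dig x) 0 17 = family_right); last by [].
rewrite (_ : rdigits (dig x') 0 17 = family_right); last by [].
have itv c j : 0 <= fwd (word_cf c) j <= 1.
  by have := fwd_word_itv c j; lra.
apply: le_trans (cfr_sep _ (itv _ _) (itv _ _)) => //.
rewrite ler_wpM2l ?exprn_ge0 ?divr_ge0 //.
rewrite add0r (fwd_cfr (reg b 17 n)) (fwd_cfr (reg b' 17 n)) -/x -/x' -eqR.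
have small : all (fun a => a <= 2)%N (rdigits (dig x) 17 n).
  apply: all_rdigits => t ht.
  have -> : 17 + t = 18%:Z + `|(t - 1)%R|%N%:Z by lia.
  by rewrite [dig _ _]wordR; case: (b _).
apply: le_trans (cfr_sep_small small (fwd_word_itv _ _) (fwd_word_itv _ _)).
rewrite size_rdigits.
rewrite ler_wpM2l ?exprn_ge0 ?divr_ge0 //.
have step c : fwd (word_cf c) (17 + n%:Z) =
              ((free_digit (c n))%:R + fwd (word_cf c) (18%:Z + n%:Z))^-1.
  have [_ _ _ -> _] := word_regular c (17 + n%:Z).
  have -> : 17 + n%:Z + 1 = 18%:Z + n%:Z by lia.
  by rewrite [dig _ _]wordR.
have far (u v : R) : 1 / 4 <= u <= 4 / 5 -> 1 / 4 <= v <= 4 / 5 -> 1 / 9 <= (1 + u)^-1 - (2 + v)^-1.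
  move=> hu hv.
  have -> : (1 + u)^-1 - (2 + v)^-1 = (1 + v - u) / ((1 + u) * (2 + v)).
    by field; apply/andP; split; lra.
  by rewrite ler_pdivlMr ?mulr_gt0; nra.
rewrite !step.
have [_ h _ _ _] := word_regular b (18%:Z + n%:Z).
have [_ h' _ _ _] := word_regular b' (18%:Z + n%:Z).
case: (b n) (b' n) neqb => [] [] // _ /=.
  by apply: le_trans (far _ _ h h') (ler_norm _).
by rewrite distrC; apply: le_trans (far _ _ h' h) (ler_norm _).
Qed.
End Family.

(** * Covers of the Cantor set by cylinders *)

Section Cylinders.
Variable R : realType.
Implicit Types (x y z : nat -> bool) (w : seq bool).
Local Notation half := (2^-1 : R).

(** The measure of the intersection of two cylinders of {0,1}^N for the fair coin measure: the
    sequences that start like x up to n, and those that start with w. *)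
Definition mass x n w : R :=
  if take (size w) (mkseq x n) == take n w then half ^+ maxn n (size w) else 0.

Lemma mass_ge0 x n w : 0 <= mass x n w.
Proof. by rewrite /mass; case: ifP => // _; rewrite exprn_ge0 // invr_ge0. Qed.

Lemma mass_split x n w : mass x n w = mass x n (rcons w true) + mass x n (rcons w false).
Proof.
rewrite /mass !size_rcons; case: (boolP (size w < n)%N) => [wn|]; last rewrite -leqNgt => nw.
  rewrite (maxn_idPl (ltnW wn)) (maxn_idPl wn).
  rewrite (take_nth false) ?size_mkseq // nth_mkseq // (take_oversize (ltnW wn)).
  rewrite !(@take_oversize _ n (rcons _ _)) ?size_rcons //.
  by rewrite !eqseq_rcons; case: (_ == w); case: (x _); rewrite /= ?addr0 ?add0r.
rewrite (maxn_idPr nw) (maxn_idPr (leqW nw)) -!cats1 !takel_cat //.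
rewrite ![take _ (mkseq _ _)]take_oversize ?size_mkseq //; last exact: leqW.
case: ifP => _; last by rewrite addr0.
by rewrite exprS; field.
Qed.

Lemma mass_nil x n : mass x n [::] = half ^+ n.
Proof. by rewrite /mass take0 /= maxn0. Qed.

Lemma mass_full x n : mass x n (mkseq x n) = half ^+ n.
Proof. by rewrite /mass size_mkseq eqxx maxnn. Qed.

(** Choose the bits of z one after the other so that the total mass of the cylinders inside the
    current one stays below its own mass. A cylinder containing z would contribute the whole
    mass of one of these. *)
Lemma light_cylinders_miss (x : nat -> nat -> bool) (n : nat -> nat) :
  (\sum_(k <oo) (half ^+ n k)%:E < 1)%E ->
  exists z, forall k, exists2 i, (i < n k)%N & z i != x k i.
Proof.
move=> lt1; pose S w := (\sum_(k <oo) (mass (x k) (n k) w)%:E)%E.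
have S_split w : S w = (S (rcons w true) + S (rcons w false))%E.
  rewrite /S -nneseriesD => [|k _ _|k _ _]; last 2 first.
  - by rewrite lee_fin mass_ge0.
  - by rewrite lee_fin mass_ge0.
  by apply: eq_eseriesr => k _; rewrite -EFinD -mass_split.
pose next w := rcons w (S (rcons w true) < (half ^+ (size w).+1)%:E)%E.
pose pre i := iter i next [::].
have size_pre i : size (pre i) = i by elim: i => //= i IH; rewrite size_rcons IH.
have S_pre i : (S (pre i) < (half ^+ i)%:E)%E.
  elim: i => [|i IH].
    rewrite expr0; apply: le_lt_trans lt1; apply: lee_nneseries => k *.
      by rewrite lee_fin mass_ge0.
    by rewrite mass_nil.
  rewrite [pre _]/= -/(pre i) {1}/next (size_pre i).
  case: (ltP (S (rcons (pre i) true)) (half ^+ i.+1)%:E) => [//|h].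
  rewrite ltNge; apply/negP => h'; move: IH; rewrite (S_split (pre i)) ltNge => /negP; apply.
  apply: le_trans (leeD h h'); rewrite -EFinD lee_fin exprS; lra.
pose z i := last false (pre i.+1).
have preE i : pre i = mkseq z i.
  elim: i => // i IH; rewrite mkseqS -IH /z [pre i.+1]/= -/(pre i).
  by rewrite /next last_rcons.
exists z => k; apply: contrapT => no.
have eqz : mkseq (x k) (n k) = pre (n k).
  rewrite preE; apply/eq_in_map => i; rewrite mem_iota /= => ik.
  apply: contrapT => neq; apply: no; exists i => //.
  by apply/eqP => e; apply: neq.
have := S_pre (n k); rewrite ltNge => /negP; apply.
apply: le_trans (@nneseries_lim_ge R _ xpredT 0%N k.+1 _) => [|j _ _]; last first.
  by rewrite lee_fin mass_ge0.
rewrite big_nat_recr //= -[X in (X <= _)%E]add0e; apply: leeD.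
  by apply: sume_ge0 => j _; rewrite lee_fin mass_ge0.
by rewrite -eqz mass_full.
Qed.

End Cylinders.

(** * Lower bounds for the Hausdorff dimension *)

Section HausdorffLower.
Variables (R : realType) (phi : (nat -> bool) -> R) (c rho s0 : R).
Hypotheses (c0 : 0 < c) (rho01 : 0 < rho < 1) (rho_s0 : 1 <= 2 * rho `^ s0).
Hypothesis sep : forall x y n, (forall k, (k < n)%N -> x k = y k) -> x n != y n ->
  c * rho ^+ n <= `|phi x - phi y|.

Lemma first_difference (x y : nat -> bool) i : x i != y i ->
  exists2 n, (n <= i)%N & (forall k, (k < n)%N -> x k = y k) /\ x n != y n.
Proof.
move=> hi; have ex : exists i, x i != y i by exists i.
case: (ex_minnP ex) => n hn minn; exists n; first exact: minn.
split=> // k kn; apply/eqP; apply: contraLR kn => hk.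
by rewrite -leqNgt minn.
Qed.

(** If the preimage of U contains two sequences that part at index n, the diameter of U is at least
    c rho^n, and rho^s >= rho^s0 >= 1/2. *)
Lemma half_pow_le_gauge s U x y n : 0 <= s -> s < s0 -> (diam U <= 1%:E)%E ->
    U (phi x) -> U (phi y) -> (forall k, (k < n)%N -> x k = y k) -> x n != y n ->
  ((2^-1 ^+ n)%:E <= (c `^ s)^-1%:E * hausdorff_gauge s U)%E.
Proof.
move=> s_ge0 ss0 dU Ux Uy eqxy nexy; have /andP[r0 r1] := rho01.
have ge : ((c * rho ^+ n)%:E <= diam U)%E.
  apply: (@le_trans _ _ (`|phi x - phi y|)%:E); first by rewrite lee_fin sep.
  by apply: ereal_sup_ubound; exists (phi x) => //; exists (phi y).
rewrite /hausdorff_gauge ifF; last by apply/negP => /eqP U0; move: Ux; rewrite U0.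
have crn : 0 < c * rho ^+ n by rewrite mulr_gt0 ?exprn_gt0.
case: (diam U) ge dU => // d; rewrite !lee_fin => ge _.
rewrite -ler_pdivrMl ?invr_gt0 ?powR_gt0 // invrK.
have -> : c `^ s * 2^-1 ^+ n = 2^-1 ^+ n * c `^ s by rewrite mulrC.
apply: (@le_trans _ _ ((c * rho ^+ n) `^ s)); last first.
  by apply: ge0_ler_powR => //; rewrite ?nnegrE ?(ltW crn) // (le_trans (ltW crn)).
rewrite powRM ?exprn_ge0 ?(ltW r0) ?(ltW c0) // mulrC ler_pM2l ?powR_gt0 //.
apply: (@le_trans _ _ ((rho ^+ n) `^ s0)).
  rewrite -(powR_mulrn _ (ltW r0)) powRAC powR_mulrn ?powR_ge0 //.
  by apply: lerXn2r; rewrite ?nnegrE ?invr_ge0 ?powR_ge0 //; have := rho_s0; lra.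
apply: ger_powR (ltW ss0); rewrite exprn_gt0 //= exprn_ile1 // ltW //.
Qed.

Lemma small_half_pow (d : R) : 0 < d -> exists n, 2^-1 ^+ n <= d.
Proof.
move=> d0; exists (Num.truncn d^-1).+1.
rewrite exprVn -[X in _ <= X]invrK lef_pV2 ?posrE ?invr_gt0 ?exprn_gt0 //.
apply: le_trans (ltW (truncnS_gt _)) _.
have := ltn_expl (Num.truncn d^-1).+1 (isT : 1 < 2)%N.
by rewrite -(ltr_nat R) natrX => /ltW.
Qed.

(** The preimage of U lies in the cylinder cut off at the first index where two of its elements
    differ. If there is no such index, it has at most one element and a cylinder as light as
    desired will do; the summand d pays for it. *)
Lemma cylinder_of_set s U d : 0 <= s -> s < s0 -> (diam U <= 1%:E)%E -> 0 < d ->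
  exists xn : (nat -> bool) * nat,
    (forall y, U (phi y) -> forall i, (i < xn.2)%N -> y i = xn.1 i) /\
    ((2^-1 ^+ xn.2)%:E <= (c `^ s)^-1%:E * hausdorff_gauge s U + d%:E)%E.
Proof.
move=> s_ge0 ss0 dU d0.
pose differ n := exists x y,
  [/\ U (phi x), U (phi y), (forall k, (k < n)%N -> x k = y k) & x n != y n].
have gauge0 : (0 <= (c `^ s)^-1%:E * hausdorff_gauge s U)%E.
  apply: mule_ge0; first by rewrite lee_fin invr_ge0 powR_ge0.
  by rewrite /hausdorff_gauge; case: ifP => // _; exact: poweR_ge0.
have [[n0 hn0]|no] := pselect (exists n, differ n).
  have ex : exists n, `[< differ n >] by exists n0; apply/asboolP.
  case: (ex_minnP ex) => n /asboolP[x [y [Ux Uy eqxy nexy]]] minn.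
  exists (x, n); split=> /=.
    move=> z Uz i ni; apply/eqP; apply: contraLR ni => /first_difference[m mi [eqm nem]].
    by rewrite -leqNgt (leq_trans _ mi) // minn //; apply/asboolP; exists z, x.
  apply: le_trans (half_pow_le_gauge s_ge0 ss0 dU Ux Uy eqxy nexy) _.
  by rewrite leeDl // lee_fin ltW.
have [n hn] := small_half_pow d0.
have [[x Ux]|nox] := pselect (exists x, U (phi x)).
  exists (x, n); split=> /=; last by rewrite (le_trans _ (leeDr _ gauge0)).
  move=> y Uy i _; apply/eqP; apply/negPn/negP => /first_difference[m mi [eqm nem]].
  by apply: no; exists m, y, x.
exists (fun=> true, n); split=> /=; last by rewrite (le_trans _ (leeDr _ gauge0)).
by move=> y Uy; case: nox; exists y.
Qed.

(** A cover with a small sum of gauges of order s < s0 would give cylinders of total mass less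
    than 1 whose union is {0,1}^N. *)
Lemma hausdorff_dim_ge (A : set R) : (forall x, A (phi x)) -> (s0%:E <= hausdorff_dim A)%E.
Proof.
move=> Aphi; apply: le_ereal_inf_tmp => _ [s [s_ge0 H0] <-]; rewrite lee_fin leNgt.
apply/negP => ss0; pose K := (c `^ s)^-1.
have K0 : 0 < K by rewrite invr_gt0 powR_gt0.
have : (hausdorff_content s 1 A < (K^-1 / 4)%:E)%E.
  apply: (@le_lt_trans _ _ 0%E); last by rewrite lte_fin divr_gt0 // invr_gt0.
  by rewrite -H0; apply: ereal_sup_ubound; exists 1 => //=; exact: ltr01.
case/ereal_inf_lt => _ [U [cover dU] <-] ltU.
have dpos k : 0 < (1 / 2 / (2 ^ k.+1)%:R : R) by rewrite !divr_gt0 // ltr0n expn_gt0.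
have /choice[xn hxn] := fun k => cylinder_of_set s_ge0 ss0 (dU k) (dpos k).
have gauge0 k : (0 <= K%:E * hausdorff_gauge s (U k))%E.
  apply: mule_ge0; first by rewrite lee_fin ltW.
  by rewrite /hausdorff_gauge; case: ifP => // _; exact: poweR_ge0.
have gauge1 k : (0 <= hausdorff_gauge s (U k))%E.
  by rewrite /hausdorff_gauge; case: ifP => // _; exact: poweR_ge0.
have lt1 : (\sum_(k <oo) (2^-1 ^+ (xn k).2)%:E < (1%:E : \bar R))%E.
  apply: (@le_lt_trans _ _ (\sum_(k <oo)
    (K%:E * hausdorff_gauge s (U k) + (1 / 2 / (2 ^ k.+1)%:R)%:E))%E).
    apply: lee_nneseries => k *; first by rewrite lee_fin exprn_ge0 // invr_ge0.
    by have [_] := hxn k.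
  apply: (le_lt_trans (epsilon_trick _ gauge0 _)); first by rewrite divr_ge0.
  rewrite nneseriesZl //.
  apply: (@le_lt_trans _ _ ((1 / 4)%:E + (1 / 2)%:E)%E); last by rewrite -EFinD lte_fin; lra.
  apply: leeD => //; rewrite (_ : 1 / 4 = K * (K^-1 / 4)); last by field; lra.
  by rewrite EFinM lee_pmul2l // ltW.
have [z hz] := @light_cylinders_miss R (fun k => (xn k).1) (fun k => (xn k).2) lt1.
have [k _ Uk] := cover _ (Aphi z).
have [i ik /negP] := hz k; apply; apply/eqP.
by have [h _] := hxn k; apply: h.
Qed.
End HausdorffLower.

(** * The dimension bound *)

Local Open Scope ereal_scope.

Theorem theorem1p1 (R : realType) :
  ((353 / 1000)%R : R)%:E <
  hausdorff_dim (@markov_spectrum R `\` @lagrange_spectrum R).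
Proof.
have dim : (353 / 1000 < (9 / 25 : R))%R by lra.
have rho : (0 < (4 / 25 : R) < 1)%R by apply/andP; split; lra.
(* This amounts to (25 / 4)^9 <= 2^25. *)
have half_le : ((1 : R) <= 2 * (4 / 25) `^ (9 / 25))%R.
  have x0 : (0 <= (4 / 25 : R) `^ (9 / 25))%R by exact: powR_ge0.
  have : ((1 / 2) ^+ 25 <= ((4 / 25 : R) `^ (9 / 25)) ^+ 25)%R.
    rewrite -(powR_mulrn _ x0) -powRrM (_ : 9 / 25 * 25%:R = 9%:R)%R; last by field.
    by rewrite powR_mulrn; lra.
  by rewrite ler_pXn2r ?nnegrE //; lra.
have c0 : ((0 : R) < (1 / 16) ^+ 17 * (4 / 25) * (1 / 9))%R by rewrite !mulr_gt0 ?exprn_gt0.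
have sep (b b' : nat -> bool) n : (forall k, (k < n)%N -> b k = b' k) -> b n != b' n ->
    ((1 / 16) ^+ 17 * (4 / 25) * (1 / 9) * (4 / 25) ^+ n <=
     `|family_value R b - family_value R b'|)%R.
  move=> eqb neqb; apply: le_trans (family_sep R eqb neqb).
  by move: ((1 / 16) ^+ 17)%R => k; rewrite exprS; lra.
apply: lt_le_trans (hausdorff_dim_ge c0 rho half_le sep _).
  by rewrite lte_fin.
by move=> b; split; [exact: family_markov|exact: family_not_lagrange].
Qed.
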